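(* Let $d\ge3$. For every $\varepsilon>0$ there is a finite family $\{S_i\}_{i\in\mathcal I}$ of contracting similarities of $\mathbb{R}^d$ whose attractor $F_\emptyset$ consists of a single point, but such that for every singleton $C\subset\mathbb{R}^d$ with $C\ne F_\emptyset$, the inhomogeneous attractor $F_C$ satisfies $\underline{\dim}_{\mathrm B}F_C\ge d-1-\varepsilon$.
   Context: Given contracting similarities $\{S_i\}_{i\in\mathcal I}$ of $\mathbb{R}^d$ ($\mathcal I$ finite) and a compact set $C\subseteq\mathbb{R}^d$, the inhomogeneous attractor $F_C$ is the unique non-empty compact set with $F_C=\bigcup_{i\in\mathcal I}S_i(F_C)\cup C$; the attractor $F_\emptyset$ is the unique non-empty compact set with $F_\emptyset=\bigcup_i S_i(F_\emptyset)$. The lower box dimension is $\underline{\dim}_{\mathrm B}E=\liminf_{\delta\to0}\log N_\delta(E)/(-\log\delta)$, where $N_\delta(E)$ is the number of half-open $\delta$-mesh cubes meeting $E$. *)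

(* Defs.v *)
From HB Require Import structures.
From mathcomp Require Import all_boot all_order all_algebra.
From mathcomp Require Import all_classical all_reals all_analysis.
Set Implicit Arguments. Unset Strict Implicit. Unset Printing Implicit Defensive.
Import Order.TTheory GRing.Theory Num.Theory.
Import numFieldNormedType.Exports.
Local Open Scope classical_set_scope.
Local Open Scope ring_scope.

Definition sqdist (R : realType) (d : nat) (x y : 'rV[R]_d) : R :=
  \sum_(i < d) (x ord0 i - y ord0 i) ^+ 2.

Definition contracting_similarity (R : realType) (d : nat)
    (S : 'rV[R]_d -> 'rV[R]_d) : Prop :=
  exists r : R, 0 < r /\ r < 1 /\
    forall x y, sqdist (S x) (S y) = r ^+ 2 * sqdist x y.

(* F is an inhomogeneous attractor of the IFS S with condensation set C:
   a non-empty compact set with F = \bigcup_i S_i(F) \cup C.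
   (With C = set0 this is the (homogeneous) attractor.) *)
Definition is_inhom_attractor (R : realType) (d : nat) (I : finType)
    (S : I -> 'rV[R]_d -> 'rV[R]_d) (C F : set 'rV[R]_d) : Prop :=
  F !=set0 /\ compact F /\ F = \bigcup_(i in [set: I]) (S i @` F) `|` C.

Definition mesh_cube (R : realType) (d : nat) (delta : R) (k : 'rV[int]_d)
    : set 'rV[R]_d :=
  [set x | forall i : 'I_d,
     (k ord0 i)%:~R * delta <= x ord0 i /\ x ord0 i < (k ord0 i + 1)%:~R * delta].

(* N_delta(E): number of delta-mesh cubes meeting E (+oo if infinitely many) *)
Definition N_mesh (R : realType) (d : nat) (delta : R) (E : set 'rV[R]_d)
    : \bar R :=
  (\esum_(k in [set k : 'rV[int]_d | mesh_cube delta k `&` E !=set0]) 1)%E.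

Definition box_ratio (R : realType) (d : nat) (E : set 'rV[R]_d) (delta : R)
    : \bar R :=
  match N_mesh delta E with
  | EFin n => (ln n / (- ln delta))%:E
  | +oo%E => +oo%E
  | -oo%E => -oo%E
  end.

Definition lower_box_dim (R : realType) (d : nat) (E : set 'rV[R]_d) : \bar R :=
  ereal_sup [set ereal_inf [set box_ratio E delta | delta in `]0, eta[]
            | eta in `]0, +oo[].

(* Main.v *)
(* All maps are [x -> lam (rotation of x in a coordinate triple)], so 0 is the
   attractor, and the inhomogeneous attractor contains [lam^n w c] for all words
   [w] of length [n] in the rotations. The rotations come from a finite set [G]
   of integer quaternions of norm [m] with [|G| >= m / c], [c] absolute, that is
   free modulo a prime [p | m]. For [n = 3 nu], [q = m^nu], two words are close
   at scale [1/q] when the quaternion [xb y] of norm [q^6] lies within [O(q^2)]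
   of the real axis; stripping common prefixes and counting such quaternions
   (the near-real ones are counted by sums of two squares, hence by the divisor
   bound) gives at most [q^(3+o(1))] close pairs. By Cauchy-Schwarz the words
   fill [q^(3-o(1))] cells of SO(3), and so [q^(2-o(1))] cells of any sphere orbit,
   since the stabilizers are circles. In dimension [d] one freezes one coordinate
   at a time, gaining a factor [q^(1-o(1))] each, which yields [q^(d-1-o(1))]
   cells at scale [1/q]. As [n] is only logarithmic in [q], a ratio [lam] close
   to 1 costs an arbitrarily small exponent. *)

Require Import Defs.
From HB Require Import structures.
From mathcomp Require Import all_boot all_order all_algebra.
From mathcomp Require Import zify ring lra.
Set Implicit Arguments. Unset Strict Implicit. Unset Printing Implicit Defensive.
Import Order.TTheory GRing.Theory Num.Theory.
Local Open Scope ring_scope.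

(** * The divisor bound *)

(** There are at most about [q ^ 3] words, as many as SO(3) has cells at scale [1/q], so only
    factors [q^o(1)] may be lost and the words must be spread almost evenly. This is why the
    alphabet has to be comparable in size to its norm [m], with a constant independent of [m]: the
    loss [c ^ n] is then a small power of [m ^ n] once [m] is large. Freeness comes from reduction
    modulo [p]. A letter of norm divisible by [p] becomes a 2x2 matrix of rank at most one, and a
    product of nonzero matrices of this kind is nonzero as soon as all products of neighbours are.
    So it suffices to avoid pairs of letters with zero product. Each letter has boundedly many such
    conflicts, and one candidate for each slope [t] in ['F_p] leaves a positive proportion of [p]
    letters. The exponent 3 in the count of close pairs is 1 + 2: the real part of the quotient
    takes [O(q)] values, one imaginary coordinate [O(q^2)], and the last two coordinates represent a
    given integer as a sum of two squares. *)

Lemma size_le_fibers (T U : eqType) (f : T -> U) (s : seq T) (L : seq U)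
    (M : nat) :
  {in s, forall x, f x \in L} ->
  (forall u, u \in L -> (size [seq x <- s | f x == u] <= M)%N) ->
  (size s <= size L * M)%N.
Proof.
elim: L s => [|u L IH] s hL hM.
  by case: s hL {hM} => [|x s] // /(_ x (mem_head _ _)).
rewrite -(count_predC (fun x => f x == u) s) -!size_filter /= mulSn.
apply: leq_add; first by apply: hM; rewrite mem_head.
apply: IH => [x|v hv].
  by rewrite mem_filter /= => /andP[hx /hL]; rewrite inE (negPf hx).
rewrite -filter_predI; apply: leq_trans (hM v _); last by rewrite inE hv orbT.
rewrite !size_filter; apply: sub_count => x /=; by case/andP.
Qed.

Lemma size_le_inj (T U : eqType) (f : T -> U) (s : seq T) (L : seq U) :
  uniq s -> {in s &, injective f} -> {in s, forall x, f x \in L} ->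
  (size s <= size L)%N.
Proof.
move=> us inj hL; rewrite -(size_map f); apply: uniq_leq_size.
  by rewrite map_inj_in_uniq.
by move=> _ /mapP[x hx ->]; exact: hL.
Qed.

Lemma divisors_gt0 n : (0 < n)%N -> (0 < size (divisors n))%N.
Proof.
move=> n0; have : 1%N \in divisors n by rewrite -dvdn_divisors.
by case: (divisors n).
Qed.

Lemma size_divisors_dvd m n : (0 < n)%N -> (m %| n)%N ->
  (size (divisors m) <= size (divisors n))%N.
Proof.
move=> n0 mn; have m0 : (0 < m)%N by apply: dvdn_gt0 mn.
apply: uniq_leq_size; first exact: divisors_uniq.
by move=> x; rewrite -!dvdn_divisors // => /dvdn_trans; apply.
Qed.

Lemma size_divisors_primeM p e n : prime p -> (0 < n)%N ->
  (size (divisors (p ^ e * n)) <= e.+1 * size (divisors n))%N.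
Proof.
move=> pp n0; have pn0 : (0 < p ^ e)%N by rewrite expn_gt0 prime_gt0.
rewrite -(size_iota 0 e.+1) -(size_allpairs (fun i d => (p ^ i * d)%N)).
apply: uniq_leq_size; first exact: divisors_uniq.
move=> x; rewrite -dvdn_divisors ?muln_gt0 ?pn0 // => hx.
set g := gcdn x (p ^ e).
have /(dvdn_pfactor _ _ pp)[i ie gE] : (g %| p ^ e)%N by rewrite dvdn_gcdr.
apply/allpairsPdep; exists i, (x %/ g)%N; split.
- by rewrite mem_iota /= add0n ltnS.
- rewrite -dvdn_divisors //.
  have g0 : (0 < g)%N by rewrite gcdn_gt0 pn0 orbT.
  have co : coprime (x %/ g) (p ^ e %/ g).
    by rewrite /coprime -(eqn_pmul2r g0) mul1n muln_gcdl !divnK ?dvdn_gcdl ?dvdn_gcdr.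
  rewrite -(Gauss_dvdr _ co) -(dvdn_pmul2r g0) divnK ?dvdn_gcdl //.
  by rewrite mulnAC divnK ?dvdn_gcdr.
- by rewrite -gE mulnC divnK ?dvdn_gcdl.
Qed.

(** With [f = e %/ k] one has [e.+1 <= k * f.+1 <= k * 2 ^ f]; raise this to the power [k]. *)
Lemma succ_expn_le_exp2 k e : (e.+1 ^ k <= k ^ k * 2 ^ e)%N.
Proof.
case: (posnP k) => [->|k0]; first by rewrite !expn0 mul1n expn_gt0.
have h : (e.+1 <= k * 2 ^ (e %/ k))%N.
  apply: (@leq_trans (k * (e %/ k).+1)); last by rewrite leq_mul2l ltn_expl ?orbT.
  rewrite {1}(divn_eq e k) mulnS mulnC -addnS addnC.
  by rewrite leq_add2r ltn_mod.
apply: (@leq_trans ((k * 2 ^ (e %/ k)) ^ k)); first by rewrite leq_exp2r.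
by rewrite expnMn -expnM leq_mul2l leq_exp2l // leq_trunc_div orbT.
Qed.

(** The quotient of tau(n)^k by n is a product over primes of [(e+1)^k / p^e]. A prime [p >= 2 ^ k]
    contributes at most 1 because [e+1 <= 2 ^ e], a smaller one at most [k ^ k], so the exponent
    [minn b (2 ^ k)] counts the possible bad primes. The induction on [b] strips the largest
    prime. *)
Lemma size_divisors_smooth k b n : (0 < n)%N ->
  (forall p, prime p -> (p %| n)%N -> (p < b)%N) ->
  (size (divisors n) ^ k <= (k ^ k) ^ minn b (2 ^ k) * n)%N.
Proof.
have kk : (0 < k ^ k)%N by case: k => // k; rewrite expn_gt0.
elim: b n => [|b IH] n n0 hn.
  have -> : n = 1%N.
    by apply/eqP; rewrite eqn_leq n0 andbT leqNgt; apply/negP => /pdivP[p /hn h /h].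
  by rewrite muln1 min0n exp1n.
have mono : (forall c, (k ^ k) ^ minn b c <= (k ^ k) ^ minn b.+1 c)%N.
  by move=> c; rewrite leq_pexp2l // leq_min geq_minr andbT (leq_trans (geq_minl _ _)).
case: (boolP (prime b)) => [pb|npb]; last first.
  apply: leq_trans (IH n n0 _) _.
    move=> p pp pn; move: (hn p pp pn); rewrite ltnS leq_eqVlt => /orP[/eqP pE|//].
    by rewrite -pE pp in npb.
  by rewrite leq_mul2r mono orbT.
set e := logn b n; pose n' := (n %/ b ^ e)%N.
have bn : (b ^ e %| n)%N by apply: pfactor_dvdnn.
have nE : n = (b ^ e * n')%N by rewrite mulnC divnK.
have eE : logn b n = e by [].
clearbody n' e.
have n'0 : (0 < n')%N by move: n0; rewrite nE muln_gt0 => /andP[].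
have IH' : (size (divisors n') ^ k <= (k ^ k) ^ minn b (2 ^ k) * n')%N.
  apply: IH => // p pp pn'.
  have pn : (p %| n)%N by rewrite nE dvdn_mull.
  move: (hn p pp pn); rewrite ltnS leq_eqVlt => /orP[/eqP pE|//].
  move: pn'; rewrite pE => pn'.
  have : (b ^ e.+1 %| n)%N by rewrite nE expnSr dvdn_mul.
  by rewrite pfactor_dvdn // eE ltnn.
have h : (e.+1 ^ k * (k ^ k) ^ minn b (2 ^ k) <= (k ^ k) ^ minn b.+1 (2 ^ k) * b ^ e)%N.
  case: (leqP (2 ^ k) b) => hb.
    rewrite (minn_idPr (leqW hb)) mulnC leq_mul2l; apply/orP; right.
    apply: (@leq_trans ((2 ^ e) ^ k)); last by rewrite -expnM mulnC expnM; case: (e) => // e'; rewrite leq_exp2r.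
    by case: (k) => // k'; rewrite leq_exp2r // ltn_expl.
  rewrite (minn_idPl hb) expnS mulnAC mulnC.
  rewrite [X in (_ <= X)%N]mulnC leq_mul2l; apply/orP; right.
  apply: leq_trans (succ_expn_le_exp2 _ _) _; rewrite leq_mul2l.
  by apply/orP; right; case: (e) => // e'; rewrite leq_exp2r // prime_gt1.
rewrite {1}nE.
apply: (@leq_trans ((e.+1 * size (divisors n')) ^ k)).
  by case: (k) => // k'; rewrite leq_exp2r //; apply: size_divisors_primeM.
rewrite expnMn [X in (_ <= _ * X)%N]nE mulnA; apply: leq_trans (leq_mul h (leqnn n')).
by rewrite -mulnA leq_mul2l IH' orbT.
Qed.

(** This is tau(n) = O(n^(1/k)), written without roots. *)
Lemma divisor_bound k : exists C : nat, forall n, (0 < n)%N ->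
  (size (divisors n) ^ k <= C * n)%N.
Proof.
exists ((k ^ k) ^ (2 ^ k))%N => n n0.
have kk : (0 < k ^ k)%N by case: (k) => // ?; rewrite expn_gt0.
apply: leq_trans (@size_divisors_smooth k n.+1 n n0 _) _.
  by move=> p _ /dvdn_leq; rewrite ltnS; apply.
by rewrite leq_mul2r leq_pexp2l ?geq_minr ?orbT.
Qed.

(** * Sums of two squares *)

Lemma dvdz_mul_gcd (d k a b : int) :
  (d %| k * a)%Z -> (d %| k * b)%Z -> (d %| k * gcdz a b)%Z.
Proof.
move=> ha hb; have [u [v <-]] := Bezoutz a b.
by rewrite mulrDr ![k * (_ * _)]mulrCA rpredD // dvdz_mull.
Qed.

(* [x / y] and [x0 / y0] are square roots of -1 mod [n], hence agree up to sign *)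
(* modulo each of the two gcds, whose product is a multiple of [n].             *)
Lemma dvd_double_cross (n : nat) (x0 y0 x y x' y' : int) :
  x0 ^+ 2 + y0 ^+ 2 = n%:Z -> x ^+ 2 + y ^+ 2 = n%:Z ->
  coprimez x0 y0 -> coprimez x y ->
  gcdz n (x * y0 - x0 * y) = gcdz n (x' * y0 - x0 * y') ->
  gcdz n (x * y0 + x0 * y) = gcdz n (x' * y0 + x0 * y') ->
  (n%:Z %| 2 * (x * y' - x' * y))%Z.
Proof.
move=> h0 h c0 c; set g := gcdz _ (x * y0 - _); set g' := gcdz _ (x * y0 + _ * y) => eg eg'.
have cn (a b : int) : a ^+ 2 + b ^+ 2 = n%:Z -> coprimez a b -> coprimez n a.
  move=> <- ab; rewrite /coprimez gcdzC expr2 gcdzMDl.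
  by rewrite -/(coprimez _ _) coprimezXr.
have cy0 : coprimez n y0 by apply: (cn y0 x0); rewrite 1?addrC // coprimez_sym.
have cx : coprimez n x by apply: (cn x y).
have gn : (g %| n%:Z)%Z by apply: dvdz_gcdl.
have g'n : (g' %| n%:Z)%Z by apply: dvdz_gcdl.
have gu : (g %| x * y0 - x0 * y)%Z by apply: dvdz_gcdr.
have gu' : (g %| x' * y0 - x0 * y')%Z by rewrite eg; apply: dvdz_gcdr.
have gv : (g' %| x * y0 + x0 * y)%Z by apply: dvdz_gcdr.
have gv' : (g' %| x' * y0 + x0 * y')%Z by rewrite eg'; apply: dvdz_gcdr.
have cop (k : int) : (k %| n%:Z)%Z -> coprimez k y0.
  by move=> kn; apply: coprimez_dvdl kn cy0.
have gD : (g %| x * y' - x' * y)%Z.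
  rewrite -(Gauss_dvdzr _ (cop _ gn)).
  have -> : y0 * (x * y' - x' * y) =
    (x * y0 - x0 * y) * y' - (x' * y0 - x0 * y') * y by ring.
  by rewrite rpredB // dvdz_mulr.
have g'D : (g' %| x * y' - x' * y)%Z.
  rewrite -(Gauss_dvdzr _ (cop _ g'n)).
  have -> : y0 * (x * y' - x' * y) =
    (x * y0 + x0 * y) * y' - (x' * y0 + x0 * y') * y by ring.
  by rewrite rpredB // dvdz_mulr.
(* The product of the two linear forms is [n * (x^2 - x0^2)], hence [n] divides [g * g']. *)
have ngg : (n%:Z %| g * g')%Z.
  apply: dvdz_mul_gcd; first by rewrite dvdz_mull.
  rewrite mulrC; apply: dvdz_mul_gcd; first by rewrite dvdz_mull.
  have -> : (x * y0 + x0 * y) * (x * y0 - x0 * y) =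
     x ^+ 2 * (x0 ^+ 2 + y0 ^+ 2) - x0 ^+ 2 * (x ^+ 2 + y ^+ 2) by ring.
  by rewrite h h0 rpredB // dvdz_mull.
(* Both gcds divide the cross product, so their product divides it up to the factor [h2]. This
   factor is at most 2: it divides the sum [2 * x * y0] of the two forms and is coprime to
   [x * y0]. *)
set h2 := gcdz g g'.
have h22 : (h2 %| 2)%Z.
  have hn : (h2 %| n%:Z)%Z by apply: dvdz_trans gn; apply: dvdz_gcdl.
  have c1 : coprimez h2 (y0 * x).
    by rewrite coprimezMr (cop _ hn) (coprimez_dvdl hn cx).
  rewrite -(Gauss_dvdzr _ c1).
  have -> : y0 * x * 2 = (x * y0 - x0 * y) + (x * y0 + x0 * y) by ring.
  by rewrite rpredD //; [apply: dvdz_trans gu; apply: dvdz_gcdl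
                        |apply: dvdz_trans gv; apply: dvdz_gcdr].
apply: dvdz_trans ngg _.
apply: (@dvdz_trans (h2 * (x * y' - x' * y))); last exact: dvdz_mul.
rewrite mulrC; apply: dvdz_mul_gcd; last exact: dvdz_mul.
by rewrite mulrC dvdz_mul.
Qed.

Lemma sqr_le4_mem (q : int) : q ^+ 2 <= 4 -> q \in [:: -2; -1; 0; 1; 2].
Proof.
rewrite expr2 => h; have [h1|h1] := lerP q 2; last by nra.
have [h2|h2] := lerP (- 2) q; last by nra.
rewrite !inE; lia.
Qed.

(** Against a fixed solution, the pair of gcds of [dvd_double_cross] takes at most tau(n)^2 values.
    Inside one fibre, compare with a second fixed solution: the cross product [X] and the scalar
    product [D] satisfy [X^2 + D^2 = n^2] and [n] divides [2 X]. So [2 X / n] has 5 possible values,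
    and the sign of [D] makes 10. *)
Lemma size_primitive_two_squares (n : nat) (s : seq (int * int)) :
  (0 < n)%N -> uniq s ->
  {in s, forall z : int * int, z.1 ^+ 2 + z.2 ^+ 2 = n%:Z /\ coprimez z.1 z.2} ->
  (size s <= 10 * size (divisors n) ^ 2)%N.
Proof.
move=> n0 us hs; case: (posnP (size s)) => [-> //|].
case sE: {1}s => [//|[x0 y0] s0] _.
have z0 : (x0, y0) \in s by rewrite sE mem_head.
have [/= h0 c0] := hs _ z0.
pose f (z : int * int) : nat * nat :=
  (gcdn n `|(z.1 * y0 - x0 * z.2)%R|, gcdn n `|(z.1 * y0 + x0 * z.2)%R|).
rewrite mulnC expnS expn1 -(size_allpairs (fun a b => (a, b))).
apply: (size_le_fibers (f := f)) => [z hz|u hu].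
  by apply: (@allpairs_f _ _ _ (fun a b => (a, b)));
    rewrite -dvdn_divisors // dvdn_gcdl.
set s' := [seq _ <- _ | _].
case: (posnP (size s')) => [-> //|].
case s'E: {1}s' => [//|[x1 y1] s1] _.
have : (x1, y1) \in s' by rewrite s'E mem_head.
rewrite mem_filter => /andP[/eqP f1 z1].
have [/= h1 c1] := hs _ z1.
pose D (z : int * int) := x1 * z.1 + y1 * z.2.
pose X (z : int * int) := x1 * z.2 - z.1 * y1.
have hX z : z \in s' -> (n%:Z %| 2 * X z)%Z.
  case: z => x y; rewrite mem_filter => /andP[/eqP f2 /hs[/= h2 c2]].
  case: (etrans f1 (esym f2)) => e1 e2.
  by apply: (dvd_double_cross h0 h1 c0 c1); rewrite /gcdz ?e1 ?e2.
have id2 z : z \in s' -> X z ^+ 2 + D z ^+ 2 = n%:Z ^+ 2.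
  rewrite mem_filter => /andP[_ /hs[h2 _]].
  have -> : n%:Z ^+ 2 = (x1 ^+ 2 + y1 ^+ 2) * (z.1 ^+ 2 + z.2 ^+ 2).
    by rewrite h1 h2 expr2.
  by rewrite /X /D; ring.
have xE z : n%:Z * z.1 = D z * x1 - X z * y1.
  by rewrite /D /X -h1; ring.
have yE z : n%:Z * z.2 = D z * y1 + X z * x1.
  by rewrite /D /X -h1; ring.
have nZ : n%:Z != 0 by rewrite -lt0n in n0 *; lia.
pose L : seq (int * bool) :=
  [seq (a, b) | a <- [:: -2; -1; 0; 1; 2 : int], b <- [:: true; false]].
apply: (@leq_trans (size L)) => //.
apply: (@size_le_inj _ _ (fun z => ((2 * X z %/ n%:Z)%Z, 0 <= D z))).
- exact: filter_uniq.
- move=> z z' hz hz' [eX eD].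
  have XX : X z = X z'.
    apply: (@mulfI _ 2) => //.
    by rewrite -(divzK (hX _ hz)) -(divzK (hX _ hz')) eX.
  have DD : D z = D z'.
    have : D z ^+ 2 = D z' ^+ 2.
      by apply: (addrI (X z ^+ 2)); rewrite id2 // XX id2.
    move/eqP; rewrite eqf_sqr => /orP[/eqP //|/eqP].
    by move: eD; clear; case: (lerP 0 (D z)); case: (lerP 0 (D z')) => //; lia.
  apply: injective_projections; apply: (mulfI nZ); by rewrite ?xE ?yE XX DD.
- move=> z hz; apply: (@allpairs_f _ _ _ (fun a b => (a, b))); last first.
    by rewrite !inE; case: (_ <= _).
  have e := divzK (hX _ hz); set q := (_ %/ _)%Z in e *.
  have b := id2 _ hz.
  have : q ^+ 2 <= 4.
    have h : n%:Z ^+ 2 * q ^+ 2 <= n%:Z ^+ 2 * 4.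
      rewrite mulrC -exprMn e exprMn mulrC -b.
      have := sqr_ge0 (D z); clear; lia.
    by move: h; rewrite ler_pM2l // exprn_gt0 // ltz_nat.
  exact: sqr_le4_mem.
Qed.

(** Dividing by the gcd of the two coordinates reduces to primitive solutions; the choice of that
    gcd costs the third divisor factor. *)
Lemma size_two_squares (n : nat) (s : seq (int * int)) :
  (0 < n)%N -> uniq s -> {in s, forall z : int * int, z.1 ^+ 2 + z.2 ^+ 2 = n%:Z} ->
  (size s <= 10 * size (divisors n) ^ 3)%N.
Proof.
move=> n0 us hs.
rewrite (expnS _ 2) mulnCA.
apply: (size_le_fibers (f := fun z : int * int => gcdn (absz z.1) (absz z.2))).
  move=> z /hs h; rewrite -dvdn_divisors //.
  rewrite -[n]/(`|n%:Z|%N) -h -[X in (X %| _)%N]/(`|gcdz z.1 z.2|%N) -dvdzE.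
  by rewrite rpredD // exprSr dvdz_mull // ?dvdz_gcdl ?dvdz_gcdr.
move=> g _; set s' := [seq _ <- _ | _].
case: (posnP (size s')) => [-> //|].
case s'E: {1}s' => [//|z1 s1] _.
have : z1 \in s' by rewrite s'E mem_head.
rewrite mem_filter => /andP[/eqP gE z1s].
have g0 : (0 < g)%N.
  rewrite lt0n; apply/negP => /eqP g0; move: gE (hs _ z1s); rewrite g0.
  move=> e; have := dvdn_gcdl `|z1.1| `|z1.2|; have := dvdn_gcdr `|z1.1| `|z1.2|.
  by rewrite e !dvd0n !absz_eq0 => /eqP-> /eqP->; clear -n0; lia.
have gz : g%:Z != 0 by lia.
have dv z : z \in s' -> z.1 = (z.1 %/ g)%Z * g /\ z.2 = (z.2 %/ g)%Z * g.
  rewrite mem_filter => /andP[/eqP <- _].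
  by rewrite !divzK // dvdzE ?dvdn_gcdl ?dvdn_gcdr.
pose f (z : int * int) := ((z.1 %/ g)%Z, (z.2 %/ g)%Z).
have g2n : (g ^ 2 %| n)%N.
  have := hs _ z1s; have [-> ->] : z1.1 = (z1.1 %/ g)%Z * g /\ z1.2 = (z1.2 %/ g)%Z * g.
    by apply: dv; rewrite mem_filter gE eqxx.
  rewrite !exprMn -mulrDl => h.
  rewrite -[n]/(`|n%:Z|%N) -h abszM.
  by rewrite abszX dvdn_mull.
have n'0 : (0 < n %/ g ^ 2)%N by rewrite divn_gt0 ?expn_gt0 ?g0 // dvdn_leq.
apply: (@leq_trans (10 * size (divisors (n %/ g ^ 2)) ^ 2)); last first.
  rewrite leq_mul2l leq_exp2r //= size_divisors_dvd //.
  by rewrite -{2}(divnK g2n) dvdn_mulr.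
have inj : {in s' &, injective f}.
  move=> z z' /dv[a b] /dv[a' b'] [e1 e2].
  by apply: injective_projections; [rewrite a a' e1|rewrite b b' e2].
rewrite -(size_map f); apply: size_primitive_two_squares => //.
  by rewrite map_inj_in_uniq // filter_uniq.
move=> _ /mapP[z hz ->] /=.
have [e1 e2] := dv _ hz; move: hz; rewrite mem_filter => /andP[/eqP gz' /hs h].
split.
  apply: (mulIf (expf_neq0 2 gz)); rewrite mulrDl -!exprMn -e1 -e2 h.
  by rewrite -!natz -natrX -natrM divnK.
rewrite /coprimez -(inj_eq (mulIf gz)) mul1r.
by rewrite -[X in _ * X]/(`|g%:Z|%:Z) mulz_gcdl -e1 -e2 /gcdz gz'.
Qed.

(** * Quaternions *)

Notation quat A := (A * A * A * A)%type.

Section Quaternions.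
Variable A : comNzRingType.
Implicit Types x y z : quat A.

Definition qmul x y : quat A :=
  let: (a, b, c, d) := x in let: (a', b', c', d') := y in
  (a * a' - b * b' - c * c' - d * d', a * b' + b * a' + c * d' - d * c',
   a * c' - b * d' + c * a' + d * b', a * d' + b * c' - c * b' + d * a').
Definition qconj x : quat A := let: (a, b, c, d) := x in (a, - b, - c, - d).
Definition qnorm x : A :=
  let: (a, b, c, d) := x in a ^+ 2 + b ^+ 2 + c ^+ 2 + d ^+ 2.
Definition qre x : A := x.1.1.1.
Definition qimn x : A := x.1.1.2 ^+ 2 + x.1.2 ^+ 2 + x.2 ^+ 2.
Definition qscal (k : A) x : quat A :=
  let: (a, b, c, d) := x in (k * a, k * b, k * c, k * d).
Definition qsub x y : quat A :=
  let: (a, b, c, d) := x in let: (a', b', c', d') := y in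
  (a - a', b - b', c - c', d - d').
Definition q0 : quat A := (0, 0, 0, 0).
Definition q1 : quat A := (1, 0, 0, 0).

Ltac qring := rewrite /qmul /qconj /qnorm /qre /qimn /qscal /qsub /q0 /q1 /=;
  try (congr (_, _, _, _)); ring.

Lemma qmulA x y z : qmul x (qmul y z) = qmul (qmul x y) z.
Proof. by move: x y z => [[[a b] c] d] [[[a' b'] c'] d'] [[[u v] w] t]; qring. Qed.
Lemma qmul1 x : qmul x q1 = x. Proof. by move: x => [[[a b] c] d]; qring. Qed.
Lemma qmul1l x : qmul q1 x = x. Proof. by move: x => [[[a b] c] d]; qring. Qed.
Lemma qmul0 x : qmul x q0 = q0. Proof. by move: x => [[[a b] c] d]; qring. Qed.
Lemma qmul0l x : qmul q0 x = q0. Proof. by move: x => [[[a b] c] d]; qring. Qed.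
Lemma qconjM x y : qconj (qmul x y) = qmul (qconj y) (qconj x).
Proof. by move: x y => [[[a b] c] d] [[[a' b'] c'] d']; qring. Qed.
Lemma qconjK x : qconj (qconj x) = x.
Proof. by move: x => [[[a b] c] d]; rewrite /= !opprK. Qed.
Lemma qnormM x y : qnorm (qmul x y) = qnorm x * qnorm y.
Proof. by move: x y => [[[a b] c] d] [[[a' b'] c'] d']; qring. Qed.
Lemma qnormC x : qnorm (qconj x) = qnorm x.
Proof. by move: x => [[[a b] c] d]; qring. Qed.
Lemma qnorm1 : qnorm q1 = 1. Proof. qring. Qed.
Lemma qmul_conjl x y : qmul (qconj x) (qmul x y) = qscal (qnorm x) y.
Proof. by move: x y => [[[a b] c] d] [[[a' b'] c'] d']; qring. Qed.
Lemma qmul_conjr x y : qmul (qmul x y) (qconj y) = qscal (qnorm y) x.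
Proof. by move: x y => [[[a b] c] d] [[[a' b'] c'] d']; qring. Qed.
Lemma qscalMl k x y : qmul (qscal k x) y = qscal k (qmul x y).
Proof. by move: x y => [[[a b] c] d] [[[a' b'] c'] d']; qring. Qed.
Lemma qscalMr k x y : qmul x (qscal k y) = qscal k (qmul x y).
Proof. by move: x y => [[[a b] c] d] [[[a' b'] c'] d']; qring. Qed.
Lemma qscalA k l x : qscal k (qscal l x) = qscal (k * l) x.
Proof. by move: x => [[[a b] c] d]; qring. Qed.
Lemma qscal1 x : qscal 1 x = x. Proof. by move: x => [[[a b] c] d]; qring. Qed.
Lemma qscal0 x : qscal 0 x = q0. Proof. by move: x => [[[a b] c] d]; qring. Qed.
Lemma qnormZ k x : qnorm (qscal k x) = k ^+ 2 * qnorm x.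
Proof. by move: x => [[[a b] c] d]; qring. Qed.
Lemma qmul_subr x y z : qmul x (qsub y z) = qsub (qmul x y) (qmul x z).
Proof. by move: x y z => [[[a b] c] d] [[[a' b'] c'] d'] [[[u v] w] t]; qring. Qed.
(** Multiply [x y + conj(x y) = 2 Re(x y)] by [x] on the right. *)
Lemma qmul_sandwich x y :
  qmul x (qmul y x) =
  qsub (qscal (2 * qre (qmul x y)) x) (qscal (qnorm x) (qconj y)).
Proof. by move: x y => [[[a b] c] d] [[[a' b'] c'] d']; qring. Qed.
Lemma qconj0 x : qconj x = q0 -> x = q0.
Proof.
by move=> h; rewrite -(qconjK x) h /qconj /q0 oppr0.
Qed.

End Quaternions.

Arguments q0 {A}. Arguments q1 {A}.
Arguments qmul : simpl never. Arguments qconj : simpl never.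
Arguments qnorm : simpl never. Arguments qscal : simpl never.

Lemma qscal_inj (A : idomainType) (k : A) (x y : quat A) :
  k != 0 -> qscal k x = qscal k y -> x = y.
Proof.
move: x y => [[[a b] c] d] [[[a' b'] c'] d'] k0 [].
by move=> /(mulfI k0)-> /(mulfI k0)-> /(mulfI k0)-> /(mulfI k0)->.
Qed.

(* Quaternions of norm 0 behave like 2x2 matrices of rank 1: *)
(* [b x b = tr(b x) b] when [N b = 0].                        *)
Lemma qmul_rank_one (F : fieldType) (a b c : quat F) :
  (2 : F) != 0 -> qnorm b = 0 -> qmul a b <> q0 -> qmul b c <> q0 ->
  qmul a (qmul b c) <> q0.
Proof.
move=> two nb ab bc abc.
(* If [a b c = 0], then multiplying [b (c x) b = 2 Re(b c x) b] by [a] on the left gives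
   [2 Re(b c x) (a b) = 0], whereas [a b] is nonzero. *)
have tr0 x : qre (qmul (qmul b c) x) = 0.
  have := qmul_sandwich b (qmul c x); rewrite nb qscal0.
  move/(congr1 (qmul a)); rewrite !qmulA -(qmulA a b c) abc !qmul0l.
  rewrite qmul_subr qscalMr qmul0.
  move: ab; move: (qmul a b) (qre _) => [[[u v] w] t] k.
  move=> ne; rewrite /q0 /qscal /qsub !subr0 => -[].
  have [-> //|k0] := eqVneq k 0.
  have kk : 2 * k != 0 by rewrite mulf_neq0.
  do 4 (move=> /esym/eqP; rewrite mulf_eq0 (negPf kk) /= => /eqP ?).
  by case: ne; subst.
(* Testing on [1, -i, -j, -k] reads off the four coordinates of [b c]. *)
apply: bc; move: tr0; move: (qmul b c) => [[[u v] w] t] h.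
have := h (1, 0, 0, 0); have := h (0, -1, 0, 0).
have := h (0, 0, -1, 0); have := h (0, 0, 0, -1).
rewrite /qre /q0 /= !(mulr0, mulr1, mulrN1, subr0, sub0r, opprK, oppr0, add0r, addr0).
by do 4 move=> ->.
Qed.

Section Cast.
Variable A : comNzRingType.

Definition qcast (x : quat int) : quat A :=
  let: (a, b, c, d) := x in (a%:~R, b%:~R, c%:~R, d%:~R).

Lemma qcastM x y : qcast (qmul x y) = qmul (qcast x) (qcast y).
Proof.
move: x y => [[[a b] c] d] [[[a' b'] c'] d']; rewrite /qcast /qmul.
by rewrite !(rmorphB, rmorphD, rmorphM).
Qed.
Lemma qcastC x : qcast (qconj x) = qconj (qcast x).
Proof. by move: x => [[[a b] c] d]; rewrite /qcast /qconj !rmorphN. Qed.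
Lemma qnorm_cast x : qnorm (qcast x) = (qnorm x)%:~R.
Proof.
by move: x => [[[a b] c] d]; rewrite /qcast /qnorm !rmorphD !rmorphXn.
Qed.

End Cast.

Notation qred p := (@qcast 'F_p).

(** * Unique reading of products modulo a prime *)

Section ModP.
Variable p : nat.
Hypothesis pp : prime p.
Hypothesis podd : (2 < p)%N.

Lemma Fp_eq0 (a : int) : ((a%:~R : 'F_p) == 0) = (p%:Z %| a)%Z.
Proof. by rewrite (dvdz_pcharf (pchar_Fp pp)). Qed.

Lemma Fp_two : (2 : 'F_p) != 0.
Proof.
rewrite -[2]/((2%:Z)%:~R) Fp_eq0 dvdzE /=; apply/negP => /dvdn_leq.
by move=> /(_ isT); rewrite leqNgt podd.
Qed.

Lemma qred_eq0 x : qred p x = q0 -> exists z, x = qscal p%:Z z.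
Proof.
move: x => [[[a b] c] d] [/eqP + /eqP + /eqP + /eqP]; rewrite !Fp_eq0.
move=> /dvdzP[u ->] /dvdzP[v ->] /dvdzP[w ->] /dvdzP[t ->].
by exists (u, v, w, t); rewrite /qscal ![p%:Z * _]mulrC.
Qed.

Lemma qred_scal (k : int) x : (k%:~R : 'F_p) = 0 -> qred p (qscal k x) = q0.
Proof.
move=> k0; move: x => [[[a b] c] d].
by rewrite /qcast /qscal !rmorphM /= k0 !mul0r.
Qed.

Fixpoint qprod (s : seq (quat int)) : quat int :=
  if s is x :: s' then qmul x (qprod s') else q1.

Lemma qprod_cat s t : qprod (s ++ t) = qmul (qprod s) (qprod t).
Proof. by elim: s => [|x s IH] /=; rewrite ?qmul1l // IH qmulA. Qed.

Lemma qprod_conj s : qconj (qprod s) = qprod (map (@qconj _) (rev s)).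
Proof.
elim: s => [|x s IH]; first by rewrite /= /qconj /q1 oppr0.
by rewrite /= qconjM IH rev_cons -cats1 map_cat qprod_cat /= qmul1.
Qed.

Definition linked (x y : quat int) := qred p (qmul x y) != q0.

(** In each use of [qmul_rank_one] the middle factor is the second letter, so only products of
    neighbours matter. *)
Lemma qprod_linked x s : all (fun x => qnorm (qred p x) == 0) (x :: s) ->
  path linked x s -> qred p x != q0 -> qred p (qprod (x :: s)) != q0.
Proof.
elim: s x => [|y s IH] x; first by rewrite /= qmul1.
move=> /= /andP[nx /andP[ny ns]] /andP[xy pth] x0.
have y0 : qred p y != q0.
  by apply: contraNneq xy => y0; rewrite qcastM y0 qmul0.
have /eqP h : qred p (qprod (y :: s)) != q0 by apply: IH => //=; rewrite ny ns.
apply/eqP; rewrite !qcastM; apply: qmul_rank_one.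
- exact: Fp_two.
- exact/eqP.
- by move/eqP: xy; rewrite qcastM.
- by rewrite -qcastM.
Qed.

(* Unique reading: equal products force equal first letters, since otherwise *)
(* [xb y t = N(x) s] would be a linked product vanishing mod p.               *)
Lemma qprod_inj (m : nat) s t : (0 < m)%N -> (p %| m)%N ->
  all (fun x => qnorm x == m%:Z) s -> all (fun x => qnorm x == m%:Z) t ->
  sorted linked s -> sorted linked t ->
  size s = size t ->
  all (fun xy => (xy.1 == xy.2) || linked (qconj xy.1) xy.2) (zip s t) ->
  qprod s = qprod t -> s = t.
Proof.
move=> m0 pm.
have nred x : qnorm x == m%:Z -> qnorm (qred p x) == 0.
  by move=> /eqP h; rewrite qnorm_cast h Fp_eq0.
elim: s t => [|x s IH] [|y t] //= /andP[nx ns] /andP[ny nt] ps pt [sz].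
move=> /andP[hxy hst] e.
have [xy|xy] := eqVneq x y.
  rewrite -{}xy in ny pt e hxy *; congr (_ :: _); apply: IH => //.
  - exact: path_sorted ps.
  - exact: path_sorted pt.
  - have := congr1 (qmul (qconj x)) e; rewrite !qmul_conjl (eqP nx).
    by apply: qscal_inj; rewrite -lt0n in m0 *; lia.
rewrite (negPf xy) /= in hxy.
have : qred p (qprod [:: qconj x, y & t]) != q0.
  apply: qprod_linked => /=; last 1 first.
  - by apply: contraNneq hxy => h; rewrite qcastM h qmul0l.
  - rewrite !nred ?qnormC //=; apply/allP => z hz; apply: nred.
    exact: (allP nt).
  - by rewrite hxy.
rewrite /= -e qmul_conjl (eqP nx) qred_scal ?eqxx //.
by apply/eqP; rewrite Fp_eq0.
Qed.

End ModP.

(** * A free alphabet of integer quaternions *)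

(** A prime divisor of (P!)^2 + 1 exceeds [P], and modulo it the factorial is a root of -1. *)
Lemma prime_sqrt_minus1 (P : nat) : exists p : nat,
  [/\ prime p, (P < p)%N & exists s : 'F_p, s ^+ 2 = -1].
Proof.
set n := (P`! ^ 2 + 1)%N.
have n1 : (1 < n)%N by rewrite /n addn1 ltnS expn_gt0 fact_gt0.
have pp := pdiv_prime n1; exists (pdiv n); split => //.
  rewrite ltnNge; apply/negP => h.
  have : (pdiv n %| 1)%N.
    have h1 : (pdiv n %| P`! ^ 2)%N by rewrite dvdn_exp // dvdn_fact // h prime_gt0.
    by rewrite -(dvdn_addr _ h1) pdiv_dvd.
  by rewrite dvdn1 => /eqP h1; rewrite h1 in pp.
exists (P`!)%:R; apply/eqP; rewrite -subr_eq0 opprK -natrX.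
have : (n%:R : 'F_(pdiv n)) == 0 by rewrite -(dvdn_pcharf (pchar_Fp pp)) pdiv_dvd.
by rewrite /n natrD.
Qed.

Section Alphabet.
Variable p : nat.
Hypothesis pp : prime p.
Hypothesis p4 : (4 < p)%N.
Variable s : 'F_p.
Hypothesis s2 : s ^+ 2 = -1.

Let podd : (2 < p)%N. Proof. by apply: ltn_trans p4. Qed.

(* [(s - i)(1 - t j)]: the quaternions it kills from the left are the 2x2 *)
(* matrices whose image is the line of slope [t].                         *)
Definition qline (t : 'F_p) : quat 'F_p := (s, -1, - s * t, t).

(** As [s^2 = -1], the four coordinates of the product come in two proportional pairs; this is the
    codimension 2 used in the pigeonhole below. *)
Lemma qline_eq0 (t a b c d : 'F_p) :
  s * a + b + s * t * c - t * d = 0 -> s * c + d - s * t * a + t * b = 0 ->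
  qmul (qline t) (a, b, c, d) = q0.
Proof.
move=> h1 h2; have ss : s * s = -1 by rewrite -expr2.
rewrite /qmul /q0 /qline; congr (_, _, _, _).
- by rewrite -h1; ring.
- have := congr1 ( *%R s) h1; rewrite mulr0 => <-.
  by ring: ss.
- by rewrite -h2; ring.
- have := congr1 ( *%R s) h2; rewrite mulr0 => <-.
  by ring: ss.
Qed.

Lemma sqrt_floor (n : nat) : exists r, (r ^ 2 <= n < r.+1 ^ 2)%N.
Proof.
elim: n => [|n [r /andP[h1 h2]]]; first by exists 0%N.
case: (leqP (r.+1 ^ 2) n.+1) => h; last by exists r; rewrite h (leqW h1).
exists r.+1; rewrite h /=; apply: leq_ltn_trans h2 _.
by rewrite ltn_exp2r.
Qed.

(* Thue: pigeonhole on [0, sqrt p]^4, the condition having codimension 2; a *)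
(* unit factor then makes the real part nonzero.                            *)
Lemma short_in_line (t : 'F_p) : exists z : quat int, exists2 j : nat,
  (0 < j <= 4)%N & [/\ qmul (qline t) (qred p z) = q0, qnorm z = (j * p)%:Z
   & ~~ (p%:Z %| qre z)%Z].
Proof.
have [r] := sqrt_floor p; rewrite -!mulnn => /andP[rp pr].
have r_lt : (r < p)%N.
  rewrite ltnNge; apply/negP => h.
  have h1 := leq_mul h h; have h2 := leq_mul p4 (leqnn p).
  by move: rp h1 h2 p4; clear; lia.
pose I := 'I_r.+1.
pose h (x : I * I * I * I) : 'F_p * 'F_p :=
  let: (a, b, c, d) := x in
  (s * a%:R + b%:R + s * t * c%:R - t * d%:R,
   s * c%:R + d%:R - s * t * a%:R + t * b%:R).
(* There are [r.+1 ^ 4 > p ^ 2] points for the [p ^ 2] values of the two linear forms. *)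
have /injectivePn[[[[a b] c] d] [[[[a' b'] c'] d'] ne]] : ~~ injectiveb h.
  apply/negP => /injectiveP /leq_card; rewrite !card_prod !card_ord.
  by apply/negP; rewrite Fp_cast // -ltnNge -mulnA; exact: (ltn_mul pr pr).
pose z : quat int := (a%:Z - a'%:Z, b%:Z - b'%:Z, c%:Z - c'%:Z, d%:Z - d'%:Z).
move=> e; have /= e1 := congr1 fst e; have /= e2 := congr1 snd e.
have hz : qmul (qline t) (qred p z) = q0.
  rewrite /qcast /z !rmorphB /=; apply: qline_eq0.
    by move/eqP: e1; rewrite -subr_eq0 => /eqP <-; rewrite -!pmulrn; ring.
  by move/eqP: e2; rewrite -subr_eq0 => /eqP <-; rewrite -!pmulrn; ring.
(* Multiplying [qline t * z = 0] by [conj z] gives [N(z) * qline t = 0], and one coordinate of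
   [qline t] is -1. *)
have pN : (p%:Z %| qnorm z)%Z.
  rewrite -(Fp_eq0 pp) -qnorm_cast.
  have := qmul_conjr (qline t) (qred p z); rewrite hz qmul0l.
  move/(congr1 (fun x => x.1.1.2)) => /= /esym/eqP.
  by rewrite mulrN1 oppr_eq0.
have bnd (u v : I) : `|u%:Z - v%:Z| <= r%:Z.
  have := ltn_ord u; have := ltn_ord v; clear; lia.
have bnd2 (u v : I) : (u%:Z - v%:Z) ^+ 2 <= p%:Z.
  have := bnd u v => {}bnd; rewrite -real_normK ?num_real //.
  apply: (@le_trans _ _ (r%:Z ^+ 2)); first by rewrite ler_pXn2r // nnegrE.
  by rewrite -natz -natrX natz lez_nat -mulnn.
have N4 : qnorm z <= 4 * p%:Z.
  have := bnd2 a a'; have := bnd2 b b'; have := bnd2 c c'; have := bnd2 d d'.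
  rewrite /qnorm /z; clear; lia.
have N0 : 0 <= qnorm z by rewrite /qnorm /z !addr_ge0 ?sqr_ge0.
have ndv (u v : I) : u != v -> ~~ (p%:Z %| u%:Z - v%:Z)%Z.
  move=> uv; rewrite dvdzE /=; apply/negP => /dvdn_leq.
  have := bnd u v; move: uv; rewrite -val_eqE /= => uv h1 h2.
  have : (0 < `|u%:Z - v%:Z|)%N by lia.
  move=> /h2; lia.
have [u hu] : exists u : quat int, qnorm u = 1 /\ ~~ (p%:Z %| qre (qmul z u))%Z.
  have [/eqP aa|aa] := boolP (a == a'); last first.
    by exists (1, 0, 0, 0); split; [|rewrite /qre /= !(mulr1, mulr0, subr0); apply: ndv].
  have [/eqP bb|bb] := boolP (b == b'); last first.
    exists (0, -1, 0, 0); split; [by []|].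
    rewrite /qre /= !(mulr1, mulr0, mulrN1, sub0r, subr0, opprK); exact: ndv.
  have [/eqP cc|cc] := boolP (c == c'); last first.
    exists (0, 0, -1, 0); split; [by []|].
    rewrite /qre /= !(mulr1, mulr0, mulrN1, sub0r, subr0, opprK, add0r); exact: ndv.
  have [/eqP dd|dd] := boolP (d == d'); last first.
    exists (0, 0, 0, -1); split; [by []|].
    rewrite /qre /= !(mulr1, mulr0, mulrN1, sub0r, subr0, opprK, add0r); exact: ndv.
  by case/negP: ne; rewrite aa bb cc dd.
case: hu => nu ru; exists (qmul z u).
have /dvdzP[j jE] := pN.
have Np : 0 < qnorm (qmul z u).
  rewrite lt_def qnormM nu mulr1 N0 andbT; apply: contraNneq ru => nz.
  have : (z.1.1.1 = 0) * (z.1.1.2 = 0) * (z.1.2 = 0) * (z.2 = 0).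
    move: nz; rewrite /qnorm /z /=.
    move=> /eqP; rewrite !paddr_eq0 ?addr_ge0 ?sqr_ge0 // !sqrf_eq0.
    by move=> /andP[/andP[/andP[/eqP-> /eqP->] /eqP->] /eqP->].
  rewrite /qre; case: u {nu} => [[[u1 u2] u3] u4] /= hh.
  by rewrite !hh !mul0r !subr0.
rewrite qnormM nu mulr1 in Np.
have p0 : 0 < p%:Z by rewrite ltz_nat; apply: ltn_trans p4.
have jb : 0 < j <= 4 by move: N4 Np p0; rewrite jE; clear; nia.
exists `|j|%N; first by move: jb; clear; lia.
split=> //.
- by rewrite qcastM qmulA hz qmul0l.
- by rewrite qnormM nu mulr1 jE PoszM; move: jb; clear; nia.
Qed.

(** A matrix whose image lies in two distinct lines is zero, which the nonzero real part
    excludes. *)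
Lemma qline_inj (t t' : 'F_p) (z : quat int) :
  qmul (qline t) (qred p z) = q0 -> qmul (qline t') (qred p z) = q0 ->
  ~~ (p%:Z %| qre z)%Z -> t = t'.
Proof.
case: z => [[[a b] c] d]; rewrite -(Fp_eq0 pp) /qre /qcast /=.
move: (a%:~R) (b%:~R) (c%:~R) (d%:~R) => {}a {}b {}c {}d.
rewrite /qmul /qline /q0 => h h' a0.
have /= e1 := congr1 (fun x : quat 'F_p => x.1.1.1) h.
have /= e1' := congr1 (fun x : quat 'F_p => x.1.1.1) h'.
have /= e3 := congr1 (fun x : quat 'F_p => x.1.2) h.
have /= e3' := congr1 (fun x : quat 'F_p => x.1.2) h'.
apply/eqP; rewrite -subr_eq0; apply/negPn/negP => tt.
have hd : s * c - d = 0.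
  apply: (mulfI tt); rewrite mulr0.
  have := congr2 (fun u v => u - v) e1 e1'; rewrite subrr => <-; ring.
have hb : b - s * a = 0.
  apply: (mulfI tt); rewrite mulr0.
  have := congr2 (fun u v => u - v) e3 e3'; rewrite subrr => <-; ring.
case/negP: a0; have s0 : s != 0.
  by apply: contra_eq_neq s2 => ->; rewrite expr0n /= eq_sym oppr_eq0 oner_eq0.
have ts : 2 * s != 0 by rewrite mulf_neq0 // Fp_two.
apply/eqP/(mulfI ts); rewrite mulr0 -[RHS]e1.
have dE : d = s * c by apply/eqP; rewrite -subr_eq0 -oppr_eq0 opprB hd.
have bE : b = s * a by apply/eqP; rewrite -subr_eq0 hb.
rewrite {}dE {}bE. ring.
Qed.

End Alphabet.

(** The box of side -4 to 4 contains all quaternions of norm at most 16, in particular those of norm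
    [j ^ 2] with [j <= 4] that measure conflicts in [size_unlinked]. *)
Definition small_ints : seq int := [seq i%:Z - 4 | i <- iota 0 9].
Definition small_quats : seq (quat int) :=
  [seq (abc, d) | abc <- [seq (ab, c) | ab <- [seq (a, b) | a <- small_ints,
    b <- small_ints], c <- small_ints], d <- small_ints].

Lemma small_intsP (a : int) : a ^+ 2 <= 16 -> a \in small_ints.
Proof.
rewrite expr2 => h; have [h1|h1] := lerP a 4; last by nia.
have [h2|h2] := lerP (- 4) a; last by nia.
have [k kE] : exists k : nat, a = k%:Z - 4 by exists `|(a + 4)%R|%N; lia.
by rewrite kE; apply: (map_f (fun i : nat => i%:Z - 4)); rewrite mem_iota; move: h1; rewrite kE; clear; lia.
Qed.

Lemma small_quatsP (z : quat int) : qnorm z <= 16 -> z \in small_quats.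
Proof.
move: z => [[[a b] c] d]; rewrite /qnorm => h.
have := sqr_ge0 a; have := sqr_ge0 b; have := sqr_ge0 c; have := sqr_ge0 d.
move=> d0 c0 b0 a0.
have aS : a \in small_ints by apply: small_intsP; move: h a0 b0 c0 d0; clear; lia.
have bS : b \in small_ints by apply: small_intsP; move: h a0 b0 c0 d0; clear; lia.
have cS : c \in small_ints by apply: small_intsP; move: h a0 b0 c0 d0; clear; lia.
have dS : d \in small_ints by apply: small_intsP; move: h a0 b0 c0 d0; clear; lia.
pose ab := (a, b); pose abc := (a, b, c).
apply: (@allpairs_f _ _ _ (fun (x : int * int * int) d => (x, d))) (_ : abc \in _) dS.
apply: (@allpairs_f _ _ _ (fun (x : int * int) d => (x, d))) (_ : ab \in _) cS.
exact: (@allpairs_f _ _ _ (fun a b => (a, b))).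
Qed.

Section Conflicts.
Variable p : nat.
Hypothesis pp : prime p.
Hypothesis p4 : (4 < p)%N.

Lemma linkedC x y : linked p (qconj x) (qconj y) = linked p y x.
Proof.
rewrite /linked -qconjM qcastC; congr negb; apply/eqP/eqP => [/qconj0 //|->].
by rewrite /qconj /q0 oppr0.
Qed.

(* If [p] divides [u v] then [v = ub z / j] with [z = u v / p] of norm [j^2]. *)
Lemma size_unlinked (j : nat) (u : quat int) (vs : seq (quat int)) :
  (0 < j <= 4)%N -> qnorm u = (j * p)%:Z -> uniq vs ->
  {in vs, forall v, qnorm v = (j * p)%:Z /\ ~~ linked p u v} ->
  (size vs <= size small_quats)%N.
Proof.
move=> /andP[j0 j4] nu uvs hvs; have p0 : (0 < p)%N by apply: ltn_trans p4.
have pz : p%:Z != 0 by rewrite eqz_nat -lt0n.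
pose f v : quat int := let: (a, b, c, d) := qmul u v in
  ((a %/ p)%Z, (b %/ p)%Z, (c %/ p)%Z, (d %/ p)%Z).
have fE v : v \in vs -> qmul u v = qscal p%:Z (f v).
  move=> /hvs[_ /negPn/eqP /(qred_eq0 pp)[z zE]].
  rewrite zE /f zE; case: z zE => [[[a b] c] d] _.
  by rewrite /qscal !mulKz.
apply: (@size_le_inj _ _ f) => //.
  move=> v w hv hw e.
  have : qmul (qconj u) (qmul u v) = qmul (qconj u) (qmul u w) by rewrite !fE ?e.
  rewrite !qmul_conjl nu; apply: qscal_inj.
  by rewrite eqz_nat -lt0n muln_gt0 j0.
move=> v hv; apply: small_quatsP.
have [nv _] := hvs _ hv.
have := congr1 (@qnorm _) (fE _ hv); rewrite qnormM nu nv qnormZ !PoszM.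
rewrite -expr2 exprMn mulrC => /(mulfI (expf_neq0 2 pz)) <-.
by rewrite -natz -natrX natz lez_nat -mulnn (leq_mul j4 j4).
Qed.

End Conflicts.

(** * Choosing letters without conflicts *)

Lemma leq_card_bigcup (T U : finType) (S : {set T}) (B : T -> {set U}) (M : nat) :
  {in S, forall t, (#|B t| <= M)%N} -> (#|\bigcup_(t in S) B t| <= #|S| * M)%N.
Proof.
move=> hB; rewrite -sum_nat_const.
apply: (@leq_trans (\sum_(t in S) #|B t|)); last exact: leq_sum.
elim/big_rec2: _ => [|t n A tS h]; first by rewrite cards0.
by rewrite cardsU; apply: leq_trans (leq_subr _ _) _; rewrite leq_add2l.
Qed.

(** For a maximal independent set the closed neighbourhoods, of size at most [M.+1], cover [A]. *)
Lemma independent_subset (T : finType) (A : {set T}) (r : rel T) (M : nat) :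
  symmetric r -> {in A, forall t, (#|[set u in A | r t u]| <= M)%N} ->
  exists2 S : {set T}, S \subset A /\ {in S &, forall t u, t != u -> ~~ r t u}
    & (#|A| <= #|S| * M.+1)%N.
Proof.
move=> rs hM.
pose P (S : {set T}) := (S \subset A) &&
  [forall t in S, forall u in S, (t != u) ==> ~~ r t u].
have [S /maxsetP[/andP[SA /forall_inP hS] Smax] _] : {S | maxset P S & set0 \subset S}.
  apply: maxset_exists; rewrite /P sub0set /=.
  by apply/forall_inP => t; rewrite inE.
have indep : {in S &, forall t u, t != u -> ~~ r t u}.
  by move=> t u tS uS; move/forall_inP: (hS t tS) => /(_ u uS)/implyP.
exists S => //.
apply: leq_trans (leq_card_bigcup (B := fun t => t |: [set u in A | r t u]) _); last first.
  move=> t tS; rewrite cardsU1; apply: leq_trans (leq_add (leq_b1 _) (hM t _)) _ => //.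
  exact: (subsetP SA).
apply: subset_leq_card; apply/subsetP => u uA; apply/bigcupP.
have [uS|uS] := boolP (u \in S); first by exists u => //; rewrite setU11.
have [/existsP[t /andP[tS rtu]]|/existsPn h] := boolP [exists t, (t \in S) && r t u].
  by exists t => //; rewrite !inE uA rtu orbT.
have hr t : t \in S -> ~~ r t u by move=> tS; have := h t; rewrite tS.
case/negP: uS; rewrite -(Smax (u |: S)) ?setU11 ?subsetUr //.
rewrite /P subUset sub1set uA SA /=.
apply/forall_inP => t; rewrite !inE => /orP[/eqP ->|tS];
  apply/forall_inP => v; rewrite !inE => /orP[/eqP ->|vS]; apply/implyP => ne.
- by rewrite eqxx in ne.
- by rewrite rs hr.
- exact: hr.
- exact: indep.
Qed.

(** In a word over letters and conjugates, the clause [x != y] leaves out exactly the cancelling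
    neighbours; all others must be linked. A letter must also be linked to itself. *)
Definition free_alphabet (p m : nat) (G : seq (quat int)) :=
  [/\ [/\ prime p, (2 < p)%N, (0 < m)%N & (p %| m)%N], uniq G,
     {in G, forall x, qnorm x = m%:Z},
     {in G &, forall x y, linked p x y} &
     {in G &, forall x y, x != y -> linked p (qconj x) y /\ linked p x (qconj y)}].

(** Each slope gives one short quaternion of norm [j * p] with [j <= 4]. The factor
    [16 * (4 * D).+1] collects three losses: 4 for keeping the commonest [j], [(4 * D).+1] for an
    independent set in the conflict graph, and 4 for comparing [m = i * p] with [p]. *)
Lemma free_alphabet_exists : exists2 c : nat, (0 < c)%N & forall P : nat,
  exists p m G, [/\ free_alphabet p m G, (P < m)%N, (size G <= m)%N
     & (m <= c * size G)%N].
Proof.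
pose D := size small_quats; exists (16 * (4 * D).+1)%N => // P.
have [p [pp pP [s s2]]] := prime_sqrt_minus1 (P + 4).
have p4 : (4 < p)%N by apply: leq_ltn_trans pP; rewrite leq_addl.
have p2 : (2 < p)%N by apply: ltn_trans p4.
have [x {}hx] := fin_all_exists (short_in_line pp p4 s2).
have [j hj hxj] := fin_all_exists2 hx => {hx}.
pose A i := [set t | j t == i].
pose N := (\max_(i < 5) #|A i|)%N.
have card_p : #|'F_p| = p by rewrite card_Fp.
have pN : (p <= 4 * N)%N.
  rewrite -card_p cardE.
  apply: (@size_le_fibers _ _ j _ [:: 1; 2; 3; 4]%N) => [t _|i hi].
    by have := hj t; rewrite !inE; clear; lia.
  have i5 : (i < 5)%N by move: hi; rewrite !inE; clear; lia.
  apply: leq_trans (leq_bigmax (Ordinal i5)).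
  rewrite cardE; apply: uniq_leq_size; first by rewrite filter_uniq ?enum_uniq.
  by move=> t; rewrite mem_filter => /andP[jt _]; rewrite mem_enum inE.
have [i0 Ni] : {i0 : 'I_5 | N = #|A i0|} by apply: (@bigop.eq_bigmax _ (fun i : 'I_5 => #|A i|)); rewrite card_ord.
set i : nat := i0 in Ni.
have N0 : (0 < N)%N by rewrite lt0n; apply: contraTneq pN => ->; rewrite muln0 -ltnNge ltnW ?prime_gt1.
have i04 : (0 < i <= 4)%N.
  by move: N0; rewrite Ni => /card_gt0P[t]; rewrite inE => /eqP <-.
have hA t : t \in A i -> [/\ qmul (qline s t) (qred p (x t)) = q0,
    qnorm (x t) = (i * p)%:Z & ~~ (p%:Z %| qre (x t))%Z].
  by rewrite inE => /eqP ji; have := hxj t; rewrite ji.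
have xinj : {in A i &, injective x}.
  move=> t u /hA[t1 _ t3] /hA[u1 _ _] e; apply: (qline_inj pp p4 s2 t1 _ t3).
  by rewrite e.
(* Conflict in any of the four sign patterns. Conjugation swaps the roles of the letters, so [r] is
   symmetric, and each pattern accounts for at most [D] neighbours. *)
pose r t u := ~~ [&& linked p (qconj (x t)) (x u), linked p (x t) (qconj (x u)),
  linked p (x t) (x u) & linked p (qconj (x t)) (qconj (x u))].
have rs : symmetric r.
  move=> t u; rewrite /r !linkedC -[linked p (x t) (qconj _)]linkedC.
  rewrite -[linked p (qconj (x t)) (x u)]linkedC !qconjK.
  congr (~~ [&& _, _ & _]); exact: andbC.
have fib (g : quat int -> quat int) u : (forall y, qnorm (g y) = qnorm y) ->
    injective g -> qnorm u = (i * p)%:Z ->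
    (#|[set t in A i | ~~ linked p u (g (x t))]| <= D)%N.
  move=> ng ginj nu; rewrite cardE -(size_map (g \o x)).
  apply: (@size_unlinked p pp p4 i u) => //.
    rewrite map_inj_in_uniq ?enum_uniq // => t v; rewrite !mem_enum !inE.
    by move=> /andP[/eqP ht _] /andP[/eqP hv _] /ginj; apply: xinj; rewrite inE ?ht ?hv.
  move=> _ /mapP[t + ->]; rewrite mem_enum inE => /andP[/hA[_ nt _] ?] /=.
  by rewrite ng nt.
have cK : injective (@qconj int) by apply: can_inj; apply: qconjK.
have [t tA|S [SA hS] cS] := @independent_subset _ (A i) r (4 * D) rs.
  have [_ nt _] := hA _ tA.
  pose B g v := [set u in A i | ~~ linked p v (g (x u))].
  apply: (@leq_trans #|B id (qconj (x t)) :|: B (@qconj int) (x t) :|: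
     (B id (x t) :|: B (@qconj int) (qconj (x t)))|).
    apply: subset_leq_card; apply/subsetP => u; rewrite !inE /r /= !negb_and.
    by move=> /andP[-> /orP[->|/orP[->|/orP[->|->]]]]; rewrite ?orbT.
  have cU (X Y : {set 'F_p}) n1 n2 : (#|X| <= n1)%N -> (#|Y| <= n2)%N ->
      (#|X :|: Y| <= n1 + n2)%N.
    move=> h1 h2; rewrite cardsU; apply: leq_trans (leq_subr _ _) _.
    exact: leq_add.
  have -> : (4 * D = (D + D) + (D + D))%N by clear; lia.
  have nt' : qnorm (qconj (x t)) = (i * p)%:Z by rewrite qnormC.
  apply: (cU _ _ _ _ (cU _ _ _ _ _ _) (cU _ _ _ _ _ _)).
  - exact: (fib id).
  - exact: (fib _ _ (@qnormC _)).
  - exact: (fib id).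
  - exact: (fib _ _ (@qnormC _)).
pose G := [seq x t | t <- enum S].
have sG : size G = #|S| by rewrite size_map -cardE.
exists p, (i * p)%N, G; split.
- have m0 : (0 < i * p)%N by rewrite muln_gt0 (prime_gt0 pp) andbT; case/andP: i04.
  (* Modulo [p] the square of a letter is [2 Re(x) x], with real part [2 Re(x)^2]; this is where the
     nonzero real part of [short_in_line] matters. *)
  have selfl t : t \in A i -> linked p (x t) (x t).
    move=> /hA[_ nx rx]; rewrite /linked; apply/eqP.
    have -> : qmul (x t) (x t) =
        qsub (qscal (2 * qre (x t)) (x t)) (qscal (qnorm (x t)) q1).
      by case: (x t) => [[[a b] c] d]; rewrite /qmul /qsub /qscal /qre /qnorm /q1 /=;
        congr (_, _, _, _); ring.
    move/(congr1 (fun y : quat 'F_p => y.1.1.1)); move: rx; rewrite nx.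
    case: (x t) => [[[a b] c] d]; rewrite /qre /qsub /qscal /q1 /qcast /= => rx.
    rewrite mulr1 rmorphB /= PoszM [X in _ - X]rmorphM /= -[p%:Z%:~R]/(p%:R).
    rewrite pchar_Fp_0 // mulr0 subr0 rmorphM /= => /eqP.
    rewrite mulf_eq0 (Fp_eq0 pp a) (negPf rx) orbF rmorphM /= mulf_eq0.
    by rewrite (Fp_eq0 pp a) (negPf rx) orbF (negPf (Fp_two pp p2)).
  split.
  + by split => //; rewrite dvdn_mull.
  + rewrite map_inj_in_uniq ?enum_uniq // => t u; rewrite !mem_enum => tS uS.
    by apply: xinj; apply: (subsetP SA).
  + by move=> _ /mapP[t + ->]; rewrite mem_enum => /(subsetP SA)/hA[].
  + move=> _ _ /mapP[t + ->] /mapP[u + ->]; rewrite !mem_enum => tS uS.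
    have [->|ne] := eqVneq t u; first exact/selfl/(subsetP SA).
    by have := hS _ _ tS uS ne; rewrite negbK => /and4P[].
  + move=> _ _ /mapP[t + ->] /mapP[u + ->]; rewrite !mem_enum => tS uS ne.
    have tu : t != u by apply: contraNneq ne => ->.
    by have := hS _ _ tS uS tu; rewrite negbK => /and4P[].
- case/andP: i04 => i1 _; apply: (@leq_trans p); last by rewrite leq_pmull.
  by apply: leq_trans pP; rewrite ltnS leq_addr.
- rewrite sG; apply: (@leq_trans p); first by rewrite -[X in (_ <= X)%N]card_p max_card.
  by rewrite leq_pmull //; case/andP: i04.
- rewrite sG; case/andP: i04 => _ i4; move: pN cS; rewrite Ni => pN cS.
  apply: (@leq_trans (4 * (4 * #|A i|))); first exact: leq_mul.
  by rewrite mulnA -[X in (_ <= X)%N]mulnA leq_mul2l /= [X in (_ <= X)%N]mulnC.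
Qed.

(** * Words and their energy *)

Fixpoint words (G : seq (quat int)) (n : nat) : seq (seq (quat int)) :=
  if n is n'.+1 then [seq x :: w | x <- G, w <- words G n'] else [:: [::]].

Lemma size_words G n : size (words G n) = (size G ^ n)%N.
Proof. by elim: n => [|n IH] //=; rewrite size_allpairs IH expnS. Qed.

Lemma words_uniq G n : uniq G -> uniq (words G n).
Proof.
move=> uG; elim: n => [|n IH] //=; apply: allpairs_uniq => //.
by move=> [x w] [y v] _ _ [-> ->].
Qed.

Lemma wordsP G n w : w \in words G n -> size w = n /\ all (mem G) w.
Proof.
elim: n w => [|n IH] w /=; first by rewrite inE => /eqP ->.
by case/allpairsPdep=> x [v [xG /IH[sv av] ->]] /=; rewrite sv xG.
Qed.

Lemma mem_words G n w : size w = n -> all (mem G) w -> w \in words G n.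
Proof.
elim: n w => [|n IH] [|x w] //= [sw] /andP[xG aw].
by apply: (@allpairs_f _ _ _ cons) => //; apply: IH.
Qed.

Arguments words : simpl never.

Lemma qnorm_qprod (m : nat) s : all (fun x => qnorm x == m%:Z) s ->
  qnorm (qprod s) = (m ^ size s)%N%:Z.
Proof.
elim: s => [|x s IH] /=; first by rewrite qnorm1.
by move=> /andP[/eqP nx /IH ns]; rewrite qnormM nx ns expnS PoszM.
Qed.

Lemma all_zip (T : eqType) (P : pred (T * T)) (s t : seq T) :
  {in s & t, forall x y, P (x, y)} -> all P (zip s t).
Proof.
elim: s t => [|x s IH] [|y t] //= h.
rewrite h ?mem_head //=; apply: IH => u v us vt.
by apply: h; rewrite inE ?us ?vt orbT.
Qed.

Lemma sorted_total (T : eqType) (e : rel T) (G s : seq T) :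
  {in G &, forall x y, e x y} -> all (mem G) s -> sorted e s.
Proof.
move=> h; elim: s => [|x [|y s] IH] //= /andP[xG /andP[yG sG]].
by rewrite h //=; apply: IH; rewrite /= yG.
Qed.

Lemma sorted_rcons_cat (T : eqType) (e : rel T) (s t : seq T) (x y : T) :
  sorted e (rcons s x) -> e x y -> sorted e (y :: t) ->
  sorted e (rcons s x ++ y :: t).
Proof.
case: s => [|a s] /=; first by move=> _ -> ->.
by rewrite cat_path last_rcons /= => -> -> ->.
Qed.

(** Up to its norm, the inverse of the first rotation followed by composition with the second. *)
Definition quotient_word (ww : seq (quat int) * seq (quat int)) : quat int :=
  qmul (qconj (qprod ww.1)) (qprod ww.2).

Lemma quotient_wordE w v :
  quotient_word (w, v) = qprod (map (@qconj _) (rev w) ++ v).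
Proof. by rewrite /quotient_word /= qprod_conj qprod_cat. Qed.

Section Energy.
Variables (p m : nat) (G : seq (quat int)).
Hypothesis HG : free_alphabet p m G.

Lemma word_norm n w : w \in words G n -> qnorm (qprod w) = (m ^ n)%N%:Z.
Proof.
case: HG => _ _ nG _ _ /wordsP[<- aw]; apply: qnorm_qprod.
by apply: sub_all aw => x /nG ->.
Qed.

(** When the first letters differ, the reversed conjugate of one word followed by the other is
    linked throughout, even at the junction, so unique reading recovers both words from the
    product. *)
Lemma quotient_word_inj n :
  {in [pred ww | [&& ww.1 \in words G n.+1, ww.2 \in words G n.+1 &
     head q0 ww.1 != head q0 ww.2]] &, injective quotient_word}.
Proof.
case: HG => [[pp p2 m0 pm] uG nG lG cG] [w w'] [v v'].
rewrite !inE /= => /and3P[/wordsP[sw aw] /wordsP[sw' aw'] hw].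
move=> /and3P[/wordsP[sv av] /wordsP[sv' av'] hv].
rewrite !quotient_wordE => e.
have srt u u' : size u = n.+1 -> size u' = n.+1 -> all (mem G) u ->
    all (mem G) u' -> head q0 u != head q0 u' ->
    sorted (linked p) (map (@qconj _) (rev u) ++ u').
  case: u => [|x u] //; case: u' => [|y u'] // _ _ au au' /= xy.
  have [xG yG] : x \in G /\ y \in G by move: au au' => /= /andP[-> _] /andP[-> _].
  rewrite rev_cons map_rcons; apply: sorted_rcons_cat.
  - rewrite -map_rcons -rev_cons sorted_map.
    apply: (@sorted_total _ _ G); last by rewrite all_rev.
    by move=> a b aG bG /=; rewrite linkedC; apply: lG.
  - by have [] := cG _ _ xG yG xy.
  - exact: (@sorted_total _ _ G).
have nrm u u' : all (mem G) u -> all (mem G) u' ->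
    all (fun x => qnorm x == m%:Z) (map (@qconj _) (rev u) ++ u').
  move=> au au'; rewrite all_cat all_map all_rev; apply/andP; split.
    by apply: sub_all au => x /= xG; rewrite qnormC nG.
  by apply: sub_all au' => x /= xG; rewrite nG.
have e2 : map (@qconj _) (rev w) ++ w' = map (@qconj _) (rev v) ++ v'.
  apply: (qprod_inj pp p2 m0 pm) => //; try by [apply: nrm | apply: srt].
    by rewrite !size_cat !size_map !size_rev sw sw' sv sv'.
  rewrite zip_cat ?size_map ?size_rev ?sw ?sv // all_cat; apply/andP; split.
    apply: all_zip => _ _ /mapP[x xw ->] /mapP[y yv ->] /=.
    rewrite !mem_rev in xw yv; rewrite qconjK.
    have [-> |xy] := eqVneq x y; first by rewrite eqxx.
    by have [_ ->] := cG _ _ (allP aw _ xw) (allP av _ yv) xy; rewrite orbT.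
  apply: all_zip => x y xw yv /=.
  have [-> //|xy] := eqVneq x y.
  by have [-> _] := cG _ _ (allP aw' _ xw) (allP av' _ yv) xy.
move/eqP: e2; rewrite eqseq_cat ?size_map ?size_rev ?sw ?sv // => /andP[/eqP h /eqP ->].
congr (_, _); apply: (can_inj revK).
by apply: (inj_map _ h); apply: can_inj (@qconjK _).
Qed.

Definition energy (n : nat) (S : pred (quat int)) : nat :=
  size [seq ww <- [seq (w, v) | w <- words G n, v <- words G n]
       | S (quotient_word ww)].

(* Sort the pairs by the length [j] of the common prefix: it contributes the *)
(* scalar [m ^ j], and what remains is read off from its product.            *)
Lemma energy_le n (S : pred (quat int)) (tau : nat -> nat) :
  (forall j, (j <= n)%N -> forall ts : seq (quat int), uniq ts ->
     {in ts, forall t, qnorm t = ((m ^ (n - j)) ^ 2)%N%:Z /\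
                       S (qscal (m ^ j)%N%:Z t)} ->
     (size ts <= tau j)%N) ->
  (energy n S <= \sum_(j < n.+1) size G ^ j * tau j)%N.
Proof.
have uG : uniq G by case: HG.
elim: n S tau => [|n IH] S tau h.
  rewrite big_ord_recl big_ord0 addn0 mul1n.
  rewrite /energy /words /=; case: ifP => // S1.
  apply: (h 0%N (leqnn _) [:: q1]) => // t; rewrite inE => /eqP -> /=.
  move: S1; rewrite /quotient_word /= qmul1.
  by have -> : qconj q1 = q1 by move=> ?; rewrite /qconj /q1 oppr0.
pose S' := fun t => S (qscal m%:Z t).
have IH' := IH S' (fun j => tau j.+1).
rewrite big_ord_recl expn0 mul1n addnC.
under eq_bigr do rewrite lift0 expnS -mulnA.
rewrite -big_distrr /= /energy.
set s := filter _ _.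
have us : uniq s.
  by apply/filter_uniq/allpairs_uniq; rewrite ?words_uniq // => -[? ?] [? ?].
pose D := fun ww : seq (quat int) * seq (quat int) => head q0 ww.1 == head q0 ww.2.
have sP ww : ww \in s -> [/\ ww.1 \in words G n.+1, ww.2 \in words G n.+1
   & S (quotient_word ww)].
  by rewrite mem_filter => /andP[hS /allpairsPdep[w [v [? ? e]]]]; split => //; rewrite e.
clearbody s.
rewrite -(count_predC D s) -!size_filter; apply: leq_add.
  apply: (@leq_trans (size G * energy n S')); last first.
    rewrite leq_mul2l; apply/orP; right; apply: IH' => j jn ts uts hts.
    apply: (h j.+1) => // t /hts[nt St]; split; first by rewrite subSS.
    by move: St; rewrite /S' qscalA -PoszM -expnS.
  apply: (@size_le_fibers _ _ (fun ww => head q0 ww.1)) => [[w v]|x xG].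
    rewrite mem_filter => /andP[_ /sP[/wordsP[sw aw] _ _]].
    by case: w sw aw => [|x w] //= _ /andP[].
  apply: (@size_le_inj _ _ (fun ww => (behead ww.1, behead ww.2))).
  - by do 2 apply: filter_uniq.
  - move=> [w v] [w' v']; rewrite !mem_filter /D /=.
    move=> /and3P[/eqP hx /eqP hh /sP[/= /wordsP[sw _] /wordsP[sv _] _]].
    move=> /and3P[/eqP hx' /eqP hh' /sP[/= /wordsP[sw' _] /wordsP[sv' _] _]].
    case: w sw hx hh => [|a w] //= _; case: v sv => [|b v] //= _ -> <-.
    case: w' sw' hx' hh' => [|a' w'] //= _; case: v' sv' => [|b' v'] //= _ -> <-.
    by case=> -> ->.
  - move=> [w v]; rewrite !mem_filter /D /=.
    move=> /and3P[/eqP hx /eqP hh /sP[/= /wordsP[sw aw] /wordsP[sv av] hS]].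
    case: w sw aw hx hh hS => [|a w] //= [sw] /andP[aG aw] ->.
    case: v sv av => [|b v] //= [sv] /andP[_ av] <- hS.
    rewrite (@allpairs_f _ _ _ (fun w v => (w, v))) ?mem_words // andbT.
    move: hS; rewrite /S' /quotient_word /= qconjM -!qmulA qmul_conjl qscalMr.
    by case: HG => _ _ -> .
rewrite -(size_map quotient_word).
apply: (h 0%N) => //.
  rewrite map_inj_in_uniq ?filter_uniq // => ww vv.
  rewrite !mem_filter => /andP[h1 /sP[h2 h3 _]] /andP[h1' /sP[h2' h3' _]].
  by apply: (@quotient_word_inj n); rewrite inE /= ?h2 ?h3 ?h2' ?h3'.
move=> _ /mapP[ww + ->]; rewrite mem_filter => /andP[_ /sP[h2 h3 hS]].
rewrite qscal1 subn0 qnormM qnormC (word_norm h2) (word_norm h3).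
by split => //; rewrite -PoszM mulnn.
Qed.

End Energy.

(** * Counting quaternions near the real axis *)

Definition near_real (Y : nat) : pred (quat int) :=
  fun t => (0 < qre t) && (qimn t <= (Y ^ 2)%N%:Z).

(** Fix the real part ([B.+1] values) and one imaginary coordinate ([(2 * X).+1] values). The other
    two have a prescribed sum of squares [N <= Q ^ 2]; the hypothesis [0 < R] covers [N = 0]. *)
Lemma size_near_real (Q B X R : nat) (ts : seq (quat int)) : uniq ts ->
  (0 < R)%N ->
  (forall N, (0 < N <= Q ^ 2)%N -> (10 * size (divisors N) ^ 3 <= R)%N) ->
  {in ts, forall t, [/\ qnorm t = (Q ^ 2)%N%:Z, Q%:Z - B%:Z <= qre t <= Q%:Z
                     & `|t.1.1.2| <= X%:Z]} ->
  (size ts <= B.+1 * ((2 * X).+1 * R))%N.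
Proof.
move=> uts R0 hR hts.
have -> : (B.+1 * ((2 * X).+1 * R) = size
    [seq (b, x) | b <- iota 0 B.+1, x <- iota 0 (2 * X).+1] * R)%N.
  by rewrite size_allpairs !size_iota mulnA.
pose f (t : quat int) := (`|(Q%:Z - qre t)%R|%N, `|(t.1.1.2 + X%:Z)%R|%N).
apply: (size_le_fibers (f := f)).
  move=> t /hts[_ h1 h2]; apply: (@allpairs_f _ _ _ (fun a b => (a, b)));
    by rewrite mem_iota; move: h1 h2; rewrite ler_norml;
    move: (qre t) (t.1.1.2) => r x; clear; lia.
move=> u _; set s := [seq _ <- _ | _].
case: (posnP (size s)) => [-> //|]; case sE: {1}s => [//|t0 s0] _.
have t0s : t0 \in s by rewrite sE mem_head.
move: (t0s); rewrite mem_filter => /andP[/eqP f0 /hts[n0 r0 x0]].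
have hs t : t \in s -> [/\ qre t = qre t0, t.1.1.2 = t0.1.1.2, t \in ts
    & t.1.2 ^+ 2 + t.2 ^+ 2 = (Q ^ 2)%N%:Z - qre t0 ^+ 2 - t0.1.1.2 ^+ 2].
  rewrite mem_filter -f0 => /andP[/eqP[e1 e2] tts]; have [n r x] := hts _ tts.
  have e3 : qre t = qre t0 by move: e1 r r0; clear; lia.
  have e4 : t.1.1.2 = t0.1.1.2.
    by move: e2 x x0; rewrite !ler_norml; move: (t.1.1.2) (t0.1.1.2) => u1 u2; clear; lia.
  split=> //; rewrite -n -e3 -e4 /qre; move: (t) => [[[a b] c] d] /=.
  by rewrite /qnorm; ring.
have [N NE] : exists N : nat, (Q ^ 2)%N%:Z - qre t0 ^+ 2 - t0.1.1.2 ^+ 2 = N%:Z.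
  exists `|((Q ^ 2)%N%:Z - qre t0 ^+ 2 - t0.1.1.2 ^+ 2)%R|%N.
  rewrite gez0_abs //; have [_ _ _ <-] := hs _ t0s.
  by rewrite addr_ge0 ?sqr_ge0.
have inj : {in s &, injective (fun t : quat int => (t.1.2, t.2))}.
  move=> t t' /hs[a b _ _] /hs[a' b' _ _] [] ; rewrite -a' in a; rewrite -b' in b.
  move: t t' a b {a' b'} => [[[? ?] ?] ?] [[[? ?] ?] ?]; rewrite /qre /=.
  by move=> -> -> -> ->.
have us : uniq s by apply: filter_uniq.
rewrite -(size_map (fun t : quat int => (t.1.2, t.2))).
have um : uniq [seq (t.1.2, t.2) | t <- s] by rewrite map_inj_in_uniq.
case: (posnP N) => N0.
  apply: leq_trans R0; rewrite -[1%N]/(size [:: (0 : int, 0 : int)]).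
  apply: uniq_leq_size => // _ /mapP[t /hs[_ _ _ h] ->].
  move/eqP: h; rewrite NE N0 paddr_eq0 ?sqr_ge0 // !sqrf_eq0.
  by rewrite inE => /andP[/eqP -> /eqP ->].
apply: leq_trans (hR N _); last first.
  rewrite N0 /=; have := sqr_ge0 (qre t0); have := sqr_ge0 (t0.1.1.2).
  by move: NE; clear; lia.
apply: size_two_squares => // _ /mapP[t /hs[_ _ _ h] ->] /=.
by rewrite h NE.
Qed.

Lemma energy_near_real (p m : nat) (G : seq (quat int)) (nu R : nat) :
  free_alphabet p m G -> (size G <= m)%N -> (0 < R)%N ->
  (forall N, (0 < N <= (m ^ (3 * nu)) ^ 2)%N ->
     (10 * size (divisors N) ^ 3 <= R)%N) ->
  (energy G (3 * nu) (near_real (8 * (m ^ nu) ^ 2)) <=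
   (3 * nu).+1 * (1105 * (m ^ nu) ^ 3 * R))%N.
Proof.
move=> HG Gm R0 hR; set q := (m ^ nu)%N; set Y := (8 * q ^ 2)%N.
have m0 : (0 < m)%N by case: HG => -[].
have q0 : (0 < q)%N by rewrite expn_gt0 m0.
(* After removing a prefix of length [j], put [Q = q ^ 3 / m ^ j]. The imaginary part is at most
   [Y / m ^ j], and as [Q ^ 2 - qre ^ 2] is its square, [Q - qre <= Y ^ 2 / (m ^ (2 * j) * Q) = 64 *
   q / m ^ j]. *)
pose tau j := ((64 * q %/ m ^ j).+1 * ((2 * (Y %/ m ^ j)).+1 * R))%N.
apply: leq_trans (energy_le HG (tau := tau) _) _.
  move=> j jn ts uts hts.
  set Q := (m ^ (3 * nu - j))%N in hts *; set M := (m ^ j)%N in hts *.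
  have M0 : (0 < M)%N by rewrite expn_gt0 m0.
  have Q0 : (0 < Q)%N by rewrite expn_gt0 m0.
  have QM : (Q * M = q ^ 3)%N by rewrite -expnD subnK // /q -expnM mulnC.
  apply: (size_near_real (Q := Q)) => //.
    move=> N /andP[N0 NQ]; apply: hR; rewrite N0; apply: leq_trans NQ _.
    by rewrite leq_exp2r // /Q leq_pexp2l // leq_subr.
  move=> t /hts[nt /andP[]]; move: t nt => [[[a b] c] d].
  rewrite /qnorm /qre /qimn /qscal /= => nt; rewrite pmulr_rgt0; last by rewrite ltz_nat.
  move=> a0; rewrite !exprMn -!mulrDr => him.
  have imE : b ^+ 2 + c ^+ 2 + d ^+ 2 = (Q%:Z - a) * (Q%:Z + a).
    by rewrite -[X in X = _](addrK (a ^+ 2)) [X in X - _]addrC !addrA nt -mulnn PoszM; ring.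
  have im0 : 0 <= b ^+ 2 + c ^+ 2 + d ^+ 2 by rewrite !addr_ge0 ?sqr_ge0.
  have aQ : a <= Q%:Z.
    rewrite leNgt; apply/negP => h; move: im0; rewrite imE.
    have : 0 < (a - Q%:Z) * (Q%:Z + a) by rewrite mulr_gt0 //; move: h a0; clear; lia.
    by clear; lia.
  have hB : (Q%:Z - a) * M%:Z <= (64 * q)%N%:Z.
    have h1 : (Q%:Z - a) * Q%:Z <= (Q%:Z - a) * (Q%:Z + a).
      by rewrite ler_wpM2l //; move: aQ a0; clear; lia.
    have h2 : M%:Z ^+ 2 * ((Q%:Z - a) * Q%:Z) <= (Y ^ 2)%N%:Z.
      apply: le_trans him; rewrite ler_wpM2l ?sqr_ge0 //; rewrite imE; exact: h1.
    have e3 : M%:Z ^+ 2 * ((Q%:Z - a) * Q%:Z) = (Q%:Z - a) * M%:Z * (q ^ 3)%N%:Z.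
      by rewrite -QM PoszM; ring.
    have e4 : (Y ^ 2)%N%:Z = (64 * q)%N%:Z * (q ^ 3)%N%:Z.
      by rewrite -PoszM /Y; congr Posz; rewrite expnMn; clear; lia.
    by move: h2; rewrite e3 e4 ler_pM2r // ltz_nat expn_gt0 q0.
  have hX : `|b| * M%:Z <= Y%:Z.
    rewrite -(@ler_pXn2r _ 2) ?nnegrE ?mulr_ge0 // exprMn real_normK ?num_real //.
    rewrite mulrC; apply: (@le_trans _ _ (Y ^ 2)%N%:Z); last by rewrite -mulnn PoszM expr2.
    apply: le_trans him; rewrite ler_wpM2l ?sqr_ge0 //.
    by rewrite -addrA lerDl addr_ge0 ?sqr_ge0.
  split => //.
    rewrite aQ andbT.
    have [k kE] : exists k : nat, Q%:Z - a = k%:Z.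
      by exists `|(Q%:Z - a)%R|%N; move: aQ; clear; lia.
    have : (k <= 64 * q %/ M)%N by rewrite leq_divRL // -lez_nat PoszM -kE.
    by move: kE; move: (64 * q %/ M)%N => Bv; clear; lia.
  have : (`|b| <= Y %/ M)%N by rewrite leq_divRL // -lez_nat PoszM abszE.
  by move: (Y %/ M)%N => Bv; clear; lia.
apply: (@leq_trans (\sum_(j < (3 * nu).+1) 1105 * q ^ 3 * R)); last first.
  by rewrite sum_nat_const card_ord.
apply: leq_sum => j _; rewrite /tau.
have M0 : (0 < m ^ j)%N by rewrite expn_gt0 m0.
have Mq : (m ^ j <= q ^ 3)%N.
  by have := ltn_ord j; rewrite ltnS => j3; rewrite /q -expnM [(nu * 3)%N]mulnC leq_pexp2l.
have kM : (size G ^ j <= m ^ j)%N by case: (nat_of_ord j) => // i; rewrite leq_exp2r.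
have hA := leq_trunc_div (64 * q) (m ^ j); have hB := leq_trunc_div Y (m ^ j).
move: hA hB; set A := (_ %/ _)%N; set B := (Y %/ _)%N => hA hB.
rewrite 2!mulnA leq_mul2r; apply/orP; right.
apply: (@leq_trans (m ^ j * A.+1 * (2 * B).+1)); first by rewrite !leq_mul2r kM !orbT.
have BY : (B <= Y)%N by apply: leq_div.
have -> : (m ^ j * A.+1 * (2 * B).+1 = (A * m ^ j) * (2 * B).+1 + 2 * (B * m ^ j) + m ^ j)%N.
  by clear; nia.
(* With [Y = 8 * q ^ 2] this is at most [(1024 + 64 + 16 + 1) * q ^ 3], whence 1105. *)
apply: (@leq_trans (64 * q * (2 * Y).+1 + 2 * Y + q ^ 3)).
  by rewrite !leq_add // ?leq_mul2l ?hB // leq_mul // ltnS leq_mul2l BY.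
rewrite /Y.
have q1 : (q <= q ^ 3)%N by rewrite -{1}(expn1 q) leq_pexp2l.
have q2 : (q ^ 2 <= q ^ 3)%N by rewrite leq_pexp2l.
have q3 : (q * q ^ 2 = q ^ 3)%N by rewrite -expnS.
by move: q1 q2 q3; clear; nia.
Qed.

(** [R] is the actual maximum of [10 * tau(N)^3]; its [kap]-th power is at most a constant times
    [(M ^ 2) ^ 3], so [R] is [O(M^(6/kap))]. *)
Lemma divisor_bound_square (kap : nat) : (0 < kap)%N -> exists2 K : nat, (0 < K)%N &
  forall M : nat, (0 < M)%N -> exists R : nat, [/\ (0 < R)%N,
    forall N, (0 < N <= M ^ 2)%N -> (10 * size (divisors N) ^ 3 <= R)%N &
    (R ^ kap <= K * M ^ 6)%N].
Proof.
move=> k0; have [C hC] := divisor_bound kap.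
exists (10 ^ kap * C.+1 ^ 3)%N => [|M M0]; first by rewrite muln_gt0 !expn_gt0.
pose F (i : 'I_(M ^ 2)) := (10 * size (divisors i.+1) ^ 3)%N.
have M20 : (0 < M ^ 2)%N by rewrite expn_gt0 M0.
exists (\max_i F i)%N; split.
- apply: (@leq_trans (F (Ordinal M20))); last exact: leq_bigmax.
  by rewrite muln_gt0 expn_gt0 divisors_gt0.
- case=> // N /andP[_ NM]; exact: (leq_trans (leqnn (F (Ordinal NM))) (leq_bigmax _)).
- have [i ->] : {i | (\max_i F i)%N = F i} by apply: bigop.eq_bigmax; rewrite card_ord.
  rewrite /F expnMn -mulnA leq_mul2l; apply/orP; right.
  rewrite -expnM [(3 * kap)%N]mulnC expnM -[6%N]/(2 * 3)%N [(M ^ (2 * 3))%N]expnM -expnMn leq_exp2r //.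
  by apply: leq_trans (hC i.+1 isT) _; apply: leq_mul.
Qed.

(** * Collisions *)

Lemma large_fiber (T : eqType) (U : finType) (f : T -> U) (s : seq T) :
  U -> exists u, (size s <= #|U| * size [seq x <- s | f x == u])%N.
Proof.
move=> u0; pose F u := size [seq x <- s | f x == u].
have [u hu] : {u | (\max_u F u)%N = F u}.
  by apply: bigop.eq_bigmax; apply/card_gt0P; exists u0.
exists u; rewrite -/(F u) -hu cardE; apply: (size_le_fibers (f := f)).
  by move=> x _; rewrite mem_enum.
by move=> v _; apply: (leq_trans (leqnn (F v))); exact: leq_bigmax.
Qed.

Lemma representatives (T U : eqType) (f : T -> U) (s : seq T) :
  exists s' : seq T, exists r : T -> T, [/\ uniq s', {subset s' <= s},
    {in s' &, injective f} & {in s, forall x, r x \in s' /\ f (r x) = f x}].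
Proof.
elim: s => [|x s [s' [r [us ss inj hr]]]]; first by exists [::], id.
have [/hasP[y ys' /eqP fy]|/hasPn hx] := boolP (has (fun y => f y == f x) s').
  exists s', (fun z => if z == x then y else r z); split=> //.
    by move=> z /ss; rewrite inE orbC => ->.
  move=> z; rewrite inE; have [-> _|_ /= /hr //] := eqVneq z x.
  by split.
exists (x :: s'), (fun z => if z == x then x else r z); split.
- by rewrite /= us andbT; apply/negP => /hx; rewrite eqxx.
- by move=> z; rewrite !inE => /orP[->//|/ss ->]; rewrite orbT.
- move=> y z; rewrite !inE => /orP[/eqP ->|ys] /orP[/eqP ->|zs] //.
  + by move=> e; have := hx _ zs; rewrite e eqxx.
  + by move=> e; have := hx _ ys; rewrite e eqxx.
  + exact: inj.
- move=> z; rewrite !inE; have [-> _|_ /= /hr[h1 h2]] := eqVneq z x.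
    by rewrite eqxx.
  by rewrite h1 orbT.
Qed.

Definition collisions (T U : eqType) (f : T -> U) (s : seq T) : seq (T * T) :=
  [seq xy <- [seq (x, y) | x <- s, y <- s] | f xy.1 == f xy.2].

Lemma mem_collisions (T U : eqType) (f : T -> U) (s : seq T) x y :
  ((x, y) \in collisions f s) = [&& f x == f y, x \in s & y \in s].
Proof.
rewrite mem_filter /=; congr (_ && _).
apply/allpairsPdep/andP => [[a [b [? ? [-> ->]]]]|[xs ys]]; first by split.
by exists x, y.
Qed.

Lemma collisions_uniq (T U : eqType) (f : T -> U) (s : seq T) :
  uniq s -> uniq (collisions f s).
Proof. by move=> us; apply/filter_uniq/allpairs_uniq => // -[? ?] [? ?]. Qed.

(** Splits one fibre, of size [a], off the others, which have total size [b] and sum of squared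
    sizes [c]. For [n > 0] it follows from [2 a b <= n a^2 + b^2 / n]. *)
Lemma cauchy_schwarz_step (n a b c : nat) :
  (b ^ 2 <= n * c)%N -> ((a + b) ^ 2 <= n.+1 * (a ^ 2 + c))%N.
Proof.
rewrite -!mulnn => h; case: n h => [|n] h; first by nia.
suff : (2 * (a * b) <= n.+1 * (a * a) + c)%N by nia.
rewrite -(@leq_pmul2l n.+1) //.
have : (2 * ((n.+1 * a) * b) <= (n.+1 * a) * (n.+1 * a) + b * b)%N.
  by rewrite !mulnn; apply: (nat_Cauchy _ _).1.
by move: h; clear; nia.
Qed.

Lemma size_collisions (T U : eqType) (f : T -> U) (s : seq T) (L : seq U) :
  uniq s -> {in s, forall x, f x \in L} ->
  (size s ^ 2 <= size L * size (collisions f s))%N.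
Proof.
elim: L s => [|u L IH] s us hL.
  by case: s us hL => [|x s] // _ /(_ x (mem_head _ _)).
set s1 := [seq x <- s | f x == u]; set s2 := [seq x <- s | f x != u].
have sz : size s = (size s1 + size s2)%N.
  by rewrite !size_filter -(count_predC (fun x => f x == u) s).
have IH2 : (size s2 ^ 2 <= size L * size (collisions f s2))%N.
  apply: IH; first exact: filter_uniq.
  by move=> x; rewrite mem_filter => /andP[hx /hL]; rewrite inE (negPf hx).
rewrite sz /=; apply: leq_trans (cauchy_schwarz_step _ IH2) _.
rewrite leq_mul2l -mulnn -(size_allpairs pair s1 s1) -size_cat.
apply: uniq_leq_size.
  rewrite cat_uniq collisions_uniq ?filter_uniq // andbT.
  rewrite allpairs_uniq ?filter_uniq //=; last by move=> [? ?] [? ?].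
  apply/hasPn => -[x y]; rewrite mem_collisions !mem_filter => /and3P[_ /andP[hx _] _].
  apply/negP => /allpairsPdep[a [b [+ _ [e _]]]].
  by rewrite mem_filter -e (negPf hx).
move=> [x y]; rewrite mem_cat !mem_collisions => /orP[/allpairsPdep[a [b []]]|].
  rewrite !mem_filter => /andP[/eqP ha sa] /andP[/eqP hb sb] [-> ->].
  by rewrite ha hb eqxx sa.
by rewrite !mem_filter => /and3P[-> /andP[_ ->] /andP[_ ->]].
Qed.

(** * Rotations of the 3-space *)

From mathcomp Require Import boolp reals.

Section Geometry.
Variable R : realFieldType.
Implicit Types (x y g : R) (c t u : quat R).

Definition qdot c t : R := c.1.1.2 * t.1.1.2 + c.1.2 * t.1.2 + c.2 * t.2.

Lemma sqr_bound x y : 0 <= y -> `|x| <= y -> x ^+ 2 <= y ^+ 2.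
Proof. by move=> y0 h; rewrite -real_normK ?num_real // ler_pXn2r ?nnegrE. Qed.

Lemma qnorm_ge0 c : 0 <= qnorm c.
Proof. by case: c => [[[? ?] ?] ?]; rewrite /qnorm !addr_ge0 ?sqr_ge0. Qed.

(** [t] splits orthogonally into a part in the span of 1 and [c], which commutes with [c], and a
    part that anticommutes with [c]; the commutator doubles the latter. *)
Lemma qnorm_split c t : qre c = 0 -> qnorm c = 1 ->
  4 * qnorm t = 4 * qre t ^+ 2 + 4 * qdot c t ^+ 2
    + qnorm (qsub (qmul t c) (qmul c t)).
Proof.
move: c t => [[[c0 c1] c2] c3] [[[t0 t1] t2] t3]; rewrite /qre /= => -> h.
have {h} h : c1 ^+ 2 = 1 - c2 ^+ 2 - c3 ^+ 2.
  by rewrite -h /qnorm; ring.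
by rewrite /qnorm /qdot /qsub /qmul /=; ring: h.
Qed.

Lemma qnorm_sub_le t u : qnorm (qsub t u) <= 2 * (qnorm t + qnorm u).
Proof.
move: t u => [[[t0 t1] t2] t3] [[[u0 u1] u2] u3]; rewrite /qnorm /qsub /=.
have h (a b : R) : (a - b) ^+ 2 <= 2 * a ^+ 2 + 2 * b ^+ 2.
  by have := sqr_ge0 (a + b); rewrite !expr2; nra.
have := h t0 u0; have := h t1 u1; have := h t2 u2; have := h t3 u3; lra.
Qed.

(* On the sphere, the coordinate bounded away from 0 is a Lipschitz function *)
(* of the others.                                                            *)
Lemma dominant_close (a a' e k : R) : 0 < k -> 0 <= a * a' ->
  k <= a ^+ 2 -> k <= a' ^+ 2 -> `|a ^+ 2 - a' ^+ 2| <= e ->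
  4 * k * (a - a') ^+ 2 <= e ^+ 2.
Proof.
move=> k0 aa ka ka' h.
have h1 : (a ^+ 2 - a' ^+ 2) ^+ 2 <= e ^+ 2.
  by apply: sqr_bound => //; apply: le_trans h.
have h2 : k <= a * a'.
  rewrite -(@ler_pXn2r _ 2) ?nnegrE ?(ltW k0) // exprMn expr2.
  by apply: ler_pM => //; exact: ltW.
have h3 : 4 * k <= (a + a') ^+ 2 by rewrite sqrrD; lra.
apply: le_trans h1; rewrite subr_sqr exprMn [X in _ <= X]mulrC.
by rewrite ler_wpM2r ?sqr_ge0.
Qed.

(** Both points are near the circle of radius [M] in the plane of 1 and [c]; [a] is the larger plane
    coordinate and [b] the smaller. In units of [g^2 M^2], the bound 21 is 6 for [a], 1 for [b] and
    [2 * (14 + 14) / 4 = 14] for the commutators. *)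
Lemma tube_close (c t u : quat R) (M g : R) :
  qre c = 0 -> qnorm c = 1 -> 0 < M -> 0 < g -> g <= 1 / 4 ->
  qnorm t = M ^+ 2 -> qnorm u = M ^+ 2 ->
  qnorm (qsub (qmul t c) (qmul c t)) <= 14 * g ^+ 2 * M ^+ 2 ->
  qnorm (qsub (qmul u c) (qmul c u)) <= 14 * g ^+ 2 * M ^+ 2 ->
  (exists a b a' b' : R,
    [/\ (a = qre t /\ b = qdot c t) \/ (b = qre t /\ a = qdot c t),
        (a' = qre u /\ b' = qdot c u) \/ (b' = qre u /\ a' = qdot c u),
        (a - a') ^+ 2 + (b - b') ^+ 2 =
          (qre t - qre u) ^+ 2 + (qdot c t - qdot c u) ^+ 2,
        [/\ b ^+ 2 <= a ^+ 2, b' ^+ 2 <= a' ^+ 2 & 0 <= a * a'] &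
        `|b - b'| <= g * M]) ->
  qnorm (qsub t u) <= 21 * g ^+ 2 * M ^+ 2.
Proof.
move=> c0 c1 M0 g0 g4 nt nu; set X := qnorm _ => hX; set X' := qnorm _ => hX'.
move=> [a [b [a' [b' [e1 e2 e3 [ba ba' aa] bb]]]]].
have st := qnorm_split t c0 c1; rewrite nt -/X in st.
have su := qnorm_split u c0 c1; rewrite nu -/X' in su.
have {e1}st : 4 * M ^+ 2 = 4 * a ^+ 2 + 4 * b ^+ 2 + X.
  by case: e1 => -[-> ->]; rewrite st; ring.
have {e2}su : 4 * M ^+ 2 = 4 * a' ^+ 2 + 4 * b' ^+ 2 + X'.
  by case: e2 => -[-> ->]; rewrite su; ring.
have X0 : 0 <= X by apply: qnorm_ge0.
have X'0 : 0 <= X' by apply: qnorm_ge0.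
have [M20 g20] : 0 < M ^+ 2 /\ 0 < g ^+ 2 by rewrite !exprn_gt0.
have gg : g ^+ 2 <= 1 / 16 by rewrite expr2; nra.
have gM : g ^+ 2 * M ^+ 2 <= M ^+ 2 / 16 by nra.
have gM1 : g ^+ 2 * M ^+ 2 <= g * M ^+ 2 / 4 by rewrite (expr2 g); nra.
(* [2 a^2 >= a^2 + b^2 = M^2 - X / 4], and [X <= 14 / 16 * M^2] because [g <= 1 / 4]. *)
have ha : 39 / 100 * M ^+ 2 <= a ^+ 2 by lra.
have ha' : 39 / 100 * M ^+ 2 <= a' ^+ 2 by lra.
have bM : b ^+ 2 <= M ^+ 2 by have := sqr_ge0 a; lra.
have b'M : b' ^+ 2 <= M ^+ 2 by have := sqr_ge0 a'; lra.
have nM (z : R) : z ^+ 2 <= M ^+ 2 -> `|z| <= M.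
  by move=> h; rewrite -(@ler_pXn2r _ 2) ?nnegrE ?normr_ge0 ?(ltW M0) // real_normK ?num_real.
have hbb : `|b' ^+ 2 - b ^+ 2| <= 2 * g * M ^+ 2.
  rewrite subr_sqr normrM distrC.
  have h1 : `|b' + b| <= 2 * M.
    by apply: le_trans (ler_normD _ _) _; have := nM _ bM; have := nM _ b'M; lra.
  apply: le_trans (ler_pM _ _ bb h1) _ => //; rewrite (expr2 M); lra.
have hA : `|a ^+ 2 - a' ^+ 2| <= 3 * g * M ^+ 2.
  have -> : a ^+ 2 - a' ^+ 2 = (b' ^+ 2 - b ^+ 2) + (X' - X) / 4 by lra.
  apply: le_trans (ler_normD _ _) _.
  have : `|(X' - X) / 4| <= g * M ^+ 2 by rewrite ler_norml; lra.
  lra.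
have k0 : 0 < 39 / 100 * M ^+ 2 by lra.
have hd := dominant_close k0 aa ha ha' hA.
have hd2 : (a - a') ^+ 2 <= 6 * g ^+ 2 * M ^+ 2.
  rewrite -(@ler_pM2l _ (156 / 100 * M ^+ 2)); last by lra.
  have -> : 156 / 100 * M ^+ 2 * (a - a') ^+ 2 = 4 * (39 / 100 * M ^+ 2) * (a - a') ^+ 2 by lra.
  apply: le_trans hd _; rewrite !exprMn.
  have : 0 <= M ^+ 2 * (g ^+ 2 * M ^+ 2) by rewrite !mulr_ge0 // ltW.
  have -> : 3 ^+ 2 * g ^+ 2 * (M ^+ 2) ^+ 2 = 9 * (M ^+ 2 * (g ^+ 2 * M ^+ 2)) by ring.
  have -> : 156 / 100 * M ^+ 2 * (6 * g ^+ 2 * M ^+ 2) = 936 / 100 * (M ^+ 2 * (g ^+ 2 * M ^+ 2)) by ring.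
  lra.
have hb2 : (b - b') ^+ 2 <= g ^+ 2 * M ^+ 2.
  by rewrite -exprMn; apply: sqr_bound => //; rewrite mulr_ge0 // ltW.
have := qnorm_split (qsub t u) c0 c1.
have -> : qsub (qmul (qsub t u) c) (qmul c (qsub t u)) =
  qsub (qsub (qmul t c) (qmul c t)) (qsub (qmul u c) (qmul c u)).
  move: (t) (u) (c) => [[[? ?] ?] ?] [[[? ?] ?] ?] [[[? ?] ?] ?].
  by rewrite /qsub /qmul; congr (_, _, _, _); ring.
have := qnorm_sub_le (qsub (qmul t c) (qmul c t)) (qsub (qmul u c) (qmul c u)).
rewrite -/X -/X'.
have -> : qre (qsub t u) = qre t - qre u.
  by move: (t) (u) => [[[? ?] ?] ?] [[[? ?] ?] ?].
have -> : qdot c (qsub t u) = qdot c t - qdot c u.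
  move: (t) (u) (c) => [[[? ?] ?] ?] [[[? ?] ?] ?] [[[? ?] ?] ?].
  by rewrite /qdot /qsub /=; ring.
lra.
Qed.

End Geometry.

Section Core.
Variable R : realType.
Implicit Types (c q t : quat R) (g : R).

Definition rotq q c : quat R :=
  qscal (qnorm q)^-1 (qmul (qmul q c) (qconj q)).

Definition co (i : 'I_3) c : R := nth 0 [:: c.1.1.2; c.1.2; c.2] i.

Lemma rotq_pure q c : qre c = 0 -> qre (rotq q c) = 0.
Proof.
move: q c => [[[a b] c'] d] [[[x y] z] w]; rewrite /qre /= => ->.
by rewrite [X in _ * X](_ : _ = 0) ?mulr0 //; ring.
Qed.

Lemma qnorm_rotq q c : qnorm q != 0 -> qnorm (rotq q c) = qnorm c.
Proof.
move=> q0; rewrite /rotq qnormZ !qnormM qnormC.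
by rewrite exprVn [X in _ * X](_ : _ = qnorm q ^+ 2 * qnorm c); [rewrite mulKf ?expf_neq0|ring].
Qed.

Lemma rotqM q q' c : rotq (qmul q q') c = rotq q (rotq q' c).
Proof.
rewrite /rotq qnormM qconjM qscalMr qscalMl qscalA invfM.
by rewrite !qmulA.
Qed.

Lemma qnorm_pure (i j l : 'I_3) c : uniq [:: i; j; l] -> qre c = 0 ->
  qnorm c = co i c ^+ 2 + co j c ^+ 2 + co l c ^+ 2.
Proof.
move: i j l => [[|[|[|//]]] ?] [[|[|[|//]]] ?] [[|[|[|//]]] ?] //= _;
move: c => [[[a b] c'] d]; rewrite /qre /= => ->; rewrite /co /qnorm /=; ring.
Qed.

Lemma co_sub (i : 'I_3) c c' : co i (qsub c c') = co i c - co i c'.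
Proof.
by move: c c' i => [[[? ?] ?] ?] [[[? ?] ?] ?] [[|[|[|//]]] ?].
Qed.

(** The squares of the dominant coordinate differ by at most [4 g], so [dominant_close] with
    [k = 1 / 3] gives [12 g^2] for it; the other two coordinates add [g^2] each. *)
Lemma patch_close (i j l : 'I_3) c c' g : uniq [:: i; j; l] ->
  qre c = 0 -> qre c' = 0 -> qnorm c = 1 -> qnorm c' = 1 ->
  1 / 3 <= co i c ^+ 2 -> 1 / 3 <= co i c' ^+ 2 -> 0 <= co i c * co i c' ->
  0 < g -> `|co j c - co j c'| <= g -> `|co l c - co l c'| <= g ->
  qnorm (qsub c c') <= 14 * g ^+ 2.
Proof.
move=> uni p p' n n' hi hi' s g0 hj hl.
have e := qnorm_pure uni p; have e' := qnorm_pure uni p'.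
have e2 : qre (qsub c c') = 0.
  by move: p p'; rewrite /qre; case: (c) (c') => [[[? ?] ?] ?] [[[? ?] ?] ?] /= -> ->; rewrite subr0.
rewrite (qnorm_pure uni e2) !co_sub.
rewrite n in e; rewrite n' in e'.
move: (co i c) (co j c) (co l c) (co i c') (co j c') (co l c') hi hi' s hj hl e e'.
move=> x y z x' y' z' hi hi' s hj hl e e'.
have b1 (u : R) : u ^+ 2 <= 1 -> `|u| <= 1.
  by move=> h; rewrite -(@ler_pXn2r _ 2) ?nnegrE // real_normK ?num_real // expr1n.
have d (u u' : R) : u ^+ 2 <= 1 -> u' ^+ 2 <= 1 -> `|u - u'| <= g ->
    `|u' ^+ 2 - u ^+ 2| <= 2 * g.
  move=> h h' hu; rewrite subr_sqr normrM distrC mulrC.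
  apply: ler_pM => //; apply: le_trans (ler_normD _ _) _.
  by have := b1 _ h; have := b1 _ h'; lra.
have [[x0 y0] z0] := (sqr_ge0 x, sqr_ge0 y, sqr_ge0 z).
have [[x0' y0'] z0'] := (sqr_ge0 x', sqr_ge0 y', sqr_ge0 z').
have hd : `|x ^+ 2 - x' ^+ 2| <= 4 * g.
  have -> : x ^+ 2 - x' ^+ 2 = (y' ^+ 2 - y ^+ 2) + (z' ^+ 2 - z ^+ 2) by lra.
  apply: le_trans (ler_normD _ _) _.
  have := d y y'; have := d z z'; move=> h1 h2.
  have {}h1 : `|z' ^+ 2 - z ^+ 2| <= 2 * g by apply: h1 => //; lra.
  have {}h2 : `|y' ^+ 2 - y ^+ 2| <= 2 * g by apply: h2 => //; lra.
  lra.
have k0 : 0 < 1 / 3 :> R by lra.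
have := dominant_close k0 s hi hi' hd; rewrite exprMn.
have := sqr_bound (ltW g0) hj; have := sqr_bound (ltW g0) hl.
lra.
Qed.

(** [(t c - c t) conj(t) = conj(q) (q' c conj(q') - q c conj(q)) q]: commuting nearly with [c] means
    moving [c] by nearly the same amount. *)
Lemma rotq_commutator q q' c M : qnorm q = M -> qnorm q' = M -> M != 0 ->
  let t := qmul (qconj q) q' in
  qnorm (qsub (qmul t c) (qmul c t)) = M ^+ 2 * qnorm (qsub (rotq q' c) (rotq q c)).
Proof.
move=> nq nq' M0 t.
have nt : qnorm t = M ^+ 2 by rewrite qnormM qnormC nq nq'.
apply: (mulIf (expf_neq0 2 M0)); rewrite -[in LHS]nt -(qnormC t) -qnormM.
have -> : qmul (qsub (qmul t c) (qmul c t)) (qconj t) =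
    qmul (qconj q) (qmul (qsub (qmul (qmul q' c) (qconj q')) (qmul (qmul q c) (qconj q))) q).
  have sub_mul (x y z : quat R) : qmul (qsub x y) z = qsub (qmul x z) (qmul y z).
    move: x y z => [[[? ?] ?] ?] [[[? ?] ?] ?] [[[? ?] ?] ?].
    by rewrite /qmul /qsub; congr (_, _, _, _); ring.
  rewrite !sub_mul qmul_subr; congr qsub.
    by rewrite /t qconjM qconjK !qmulA.
  rewrite qmul_conjr nt -!qmulA qmul_conjl -[qmul (qconj q) q]qmul1 -!qmulA.
  by rewrite qmul_conjl !qscalMr qmul1 qscalA nq expr2.
have sc (x y : quat R) : qsub (qscal M^-1 x) (qscal M^-1 y) = qscal M^-1 (qsub x y).
  move: x y => [[[? ?] ?] ?] [[[? ?] ?] ?].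
  by rewrite /qscal /qsub; congr (_, _, _, _); ring.
rewrite /rotq nq nq' sc qnormZ !qnormM qnormC nq.
move: (qnorm (qsub _ _)) => N.
by rewrite exprVn; field.
Qed.

(** For the quotients [t], [u] of [w], [w'] by the same [w0], [conj(t) u = q^3 z] with [z] the
    quotient of [w] and [w']. Hence the squared distance is [2 M (M - Re z)], and the squared
    imaginary part [M^2 - (Re z)^2] is at most [21 (g q)^2 q^4], below [(8 q^2)^2]. *)
Lemma near_real_quotient (q : nat) (w0 w w' : seq (quat int)) g :
  qnorm (qprod w0) = (q ^ 3)%N%:Z -> qnorm (qprod w) = (q ^ 3)%N%:Z ->
  qnorm (qprod w') = (q ^ 3)%N%:Z -> (0 < q)%N ->
  0 < g -> g <= 1 / 4 -> g * q%:R <= 1 ->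
  qnorm (qsub (qcast R (quotient_word (w0, w))) (qcast R (quotient_word (w0, w'))))
    <= 21 * g ^+ 2 * (q ^ 3)%:R ^+ 2 ->
  near_real (8 * q ^ 2) (quotient_word (w, w')).
Proof.
move=> n0 n n' q0 g0 g4 gq; rewrite /quotient_word /=.
set x := qprod w; set y := qprod w'; set x0 := qprod w0.
set z := qmul (qconj x) y; set M := (q ^ 3)%:R.
have M0 : 0 < M :> R by rewrite ltr0n expn_gt0 q0.
have nz : qnorm z = ((q ^ 3) ^ 2)%N%:Z.
  by rewrite qnormM qnormC n n' -PoszM mulnn.
have expand (t u : quat R) : qnorm (qsub t u) =
    qnorm t + qnorm u - 2 * qre (qmul (qconj t) u).
  move: t u => [[[? ?] ?] ?] [[[? ?] ?] ?].
  by rewrite /qnorm /qsub /qre /qmul /=; ring.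
rewrite expand -qcastC -qcastM qconjM qconjK -qmulA.
have -> : qmul (qconj x) (qmul x0 (qmul (qconj x0) y)) = qscal (q ^ 3)%N%:Z z.
  rewrite [qmul x0 _]qmulA.
  have -> : qmul x0 (qconj x0) = qscal (qnorm x0) q1.
    by case: (x0) => [[[? ?] ?] ?]; rewrite /qmul /qscal /qnorm /q1 /=;
      congr (_, _, _, _); ring.
  by rewrite n0 qscalMl qmul1l qscalMr.
have nc (s t : quat int) : qnorm s = (q ^ 3)%N%:Z -> qnorm t = (q ^ 3)%N%:Z ->
    qnorm (qcast R (qmul (qconj s) t)) = M ^+ 2.
  by move=> ns nt; rewrite qnorm_cast qnormM qnormC ns nt rmorphM /= -pmulrn expr2.
rewrite !nc //.
have -> : qre (qcast R (qscal (q ^ 3)%N%:Z z)) = M * (qre z)%:~R.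
  by case: (z) => [[[? ?] ?] ?]; rewrite /qre /qcast /qscal /= rmorphM.
set r : R := (qre z)%:~R => h.
have im : (qimn z)%:~R = M ^+ 2 - r ^+ 2.
  have -> : M ^+ 2 = (qnorm z)%:~R by rewrite nz -pmulrn natrX.
  rewrite /r -rmorphXn -rmorphB /=; congr (_%:~R).
  by case: (z) => [[[? ?] ?] ?]; rewrite /qnorm /qimn /qre /=; ring.
have h1 : M - r <= 21 / 2 * g ^+ 2 * M.
  by rewrite -(@ler_pM2l _ (2 * M)) ?mulr_gt0 //; move: h; rewrite expr2; lra.
have gg : g ^+ 2 <= 1 / 16 by rewrite expr2; nra.
have r0 : 0 < r.
  have : g ^+ 2 * M <= 1 / 16 * M by rewrite ler_wpM2r // ltW.
  lra.
rewrite /near_real; apply/andP; split; first by rewrite -(ltr0z R).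
rewrite -(ler_int R) im -pmulrn.
have rM : r <= M.
  rewrite leNgt; apply/negP => Mr.
  have : 0 <= (qimn z)%:~R :> R.
    by rewrite ler0z /qimn !addr_ge0 ?sqr_ge0.
  rewrite im subr_sqr pmulr_lge0; last by lra.
  lra.
have -> : M ^+ 2 - r ^+ 2 = (M - r) * (M + r) by ring.
apply: (@le_trans _ _ (21 / 2 * g ^+ 2 * M * (2 * M))).
  by apply: ler_pM => //; lra.
rewrite natrX natrM natrX /M natrX.
have -> : 21 / 2 * g ^+ 2 * q%:R ^+ 3 * (2 * q%:R ^+ 3) = 21 * (g * q%:R) ^+ 2 * q%:R ^+ 4 :> R.
  by field.
have -> : (8%:R * q%:R ^+ 2) ^+ 2 = 64 * q%:R ^+ 4 :> R by ring.
have q40 : 0 <= q%:R ^+ 4 :> R by rewrite exprn_ge0.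
apply: ler_wpM2r => //.
have : (g * q%:R) ^+ 2 <= 1 by rewrite expr_le1 // mulr_ge0 // ltW.
lra.
Qed.

End Core.

(** * Counting cells on the 2-sphere *)

Section Bins.
Variable R : realType.
Implicit Types (c q t : quat R) (g : R).

Lemma same_sign_mul (x y : R) : (0 <= x) = (0 <= y) -> 0 <= x * y.
Proof.
case: (lerP 0 x) => [hx /esym hy|hx /esym/negbT]; first by rewrite mulr_ge0.
by rewrite -ltNge => hy; rewrite mulr_le0 // ltW.
Qed.

Lemma floor_close (x y g : R) : 0 < g ->
  Num.floor (x / g) = Num.floor (y / g) -> `|x - y| <= g.
Proof.
move=> g0 e; have := floor_itv (x / g); have := floor_itv (y / g); rewrite e.
move: (Num.floor _) => k; rewrite intrD !ler_pdivlMr // !ltr_pdivrMr //.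
move=> /andP[h1 h2] /andP[h3 h4]; rewrite ler_norml; lra.
Qed.

Definition bin_range g : seq int :=
  let K := (Num.truncn g^-1).+1 in [seq i%:Z - K%:Z | i <- iota 0 (2 * K)].

Lemma bin_rangeP g (x : R) : 0 < g -> `|x| <= 1 ->
  Num.floor (x / g) \in bin_range g.
Proof.
move=> g0 hx; rewrite /bin_range; set K := (Num.truncn _).+1.
have gK : g^-1 < K%:R.
  have := @truncn_itv R g^-1; rewrite invr_ge0 ltW // => /(_ isT)/andP[_].
  by [].
have h : `|x / g| < K%:R.
  by rewrite normrM (gtr0_norm (x := g^-1)) ?invr_gt0 //; apply: le_lt_trans gK;
    rewrite ler_piMl // invr_ge0 ltW.
move: h; rewrite ltr_norml => /andP[h1 h2].
have f1 : - K%:Z <= Num.floor (x / g).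
  by rewrite floor_ge_int rmorphN /= -pmulrn ltW.
have f2 : Num.floor (x / g) < K%:Z by rewrite floor_lt_int -pmulrn.
have [k kE] : exists k : nat, Num.floor (x / g) = k%:Z - K%:Z.
  by exists `|(Num.floor (x / g) + K%:Z)%R|%N; move: f1; clear; lia.
rewrite kE; apply: (map_f (fun i : nat => i%:Z - K%:Z)); rewrite mem_iota.
by move: f2; rewrite kE; clear; lia.
Qed.

Lemma size_bin_range g : 0 < g -> g <= 1 / 4 -> (size (bin_range g))%:R * g <= 5 / 2.
Proof.
move=> g0 g4; rewrite size_map size_iota natrM -[X in _ * X * _]natr1 -mulrA.
have : (Num.truncn g^-1)%:R <= g^-1 by rewrite truncn_le // invr_ge0 ltW.
rewrite -(ler_pM2r g0) mulVf ?gt_eqF // => h.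
lra.
Qed.

Definition word_rot c (w : seq (quat int)) : quat R := rotq (qcast R (qprod w)) c.

Section CoreCount.
Variables (p m : nat) (G : seq (quat int)) (nu E : nat).
Hypothesis HG : free_alphabet p m G.
Hypothesis HE : (energy G (3 * nu) (near_real (8 * (m ^ nu) ^ 2)) <= E)%N.

(* Words with the same cell [(j, l)] and the same sign of the dominant            *)
(* coordinate [i] have close orbit points, so their quotient [t] nearly commutes  *)
(* with [c]: it lies near the circle [qre^2 + qdot^2 = const], on which a sign    *)
(* and the smaller of the two coordinates locate it.                              *)
Lemma core_bins c g : qre c = 0 -> qnorm c = 1 -> 0 < g -> g <= 1 / 4 ->
  g * (m ^ nu)%:R <= 1 ->
  exists i j l : 'I_3, exists W : seq (seq (quat int)),
  [/\ uniq [:: i; j; l], {subset W <= words G (3 * nu)},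
      {in W, forall w, 1 / 3 <= co i (word_rot c w) ^+ 2},
      uniq W /\ {in W &, injective (fun w => (Num.floor (co j (word_rot c w) / g),
                              Num.floor (co l (word_rot c w) / g)))} &
      (size G ^ (3 * nu))%:R ^+ 2 * g <= 360 * E%:R * (size W)%:R].
Proof.
move=> c0 c1 g0 g4 gq; set Ws := words G (3 * nu).
have m0 : (0 < m)%N by case: HG => -[].
have q0 : (0 < m ^ nu)%N by rewrite expn_gt0 m0.
have nw w : w \in Ws -> qnorm (qprod w) = ((m ^ nu) ^ 3)%N%:Z.
  by move=> /(word_norm HG) ->; rewrite -expnM mulnC.
pose M : R := ((m ^ nu) ^ 3)%:R.
have M0 : 0 < M by rewrite ltr0n expn_gt0 q0.
have nwR w : w \in Ws -> qnorm (qcast R (qprod w)) = M.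
  by move=> hw; rewrite qnorm_cast nw.
have pP w : qre (word_rot c w) = 0 by apply: rotq_pure.
have nP w : w \in Ws -> qnorm (word_rot c w) = 1.
  by move=> hw; rewrite qnorm_rotq // nwR // gt_eqF.
pose big w (i : 'I_3) := 1 / 3 <= co i (word_rot c w) ^+ 2.
have bigP w : w \in Ws -> exists i, big w i.
  move=> hw; have := qnorm_pure (i := 0) (j := 1) (l := 2%:R) isT (pP w).
  rewrite nP // => h.
  have [h0|h0] := lerP (1 / 3) (co 0 (word_rot c w) ^+ 2); first by exists 0.
  have [h1|h1] := lerP (1 / 3) (co 1 (word_rot c w) ^+ 2); first by exists 1.
  by exists 2%:R; rewrite /big; lra.
(* Six classes: the index of a large coordinate and its sign. By [bigP] the default [ord0] is never
   taken for a word of [Ws]. *)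
pose cl w : 'I_3 * bool :=
  let i := odflt ord0 [pick i | big w i] in (i, 0 <= co i (word_rot c w)).
have [[i sg]] := @large_fiber _ _ cl Ws (ord0, true).
rewrite card_prod card_ord card_bool size_words.
set S := [seq _ <- _ | _] => hS.
have uG : uniq G by case: HG.
have uS : uniq S by apply/filter_uniq/words_uniq.
have SP w : w \in S -> [/\ w \in Ws, big w i & (0 <= co i (word_rot c w)) = sg].
  rewrite mem_filter /cl => /andP[/eqP + hw]; case: pickP => [a ha [<- <-] //|no].
  by have [a] := bigP _ hw; rewrite no.
have [j [l uni]] : exists j l : 'I_3, uniq [:: i; j; l].
  have w3 : forall i : 'I_3, [exists j : 'I_3, [exists l : 'I_3, uniq [:: i; j; l]]].
    move=> [[|[|[|//]]] hi].
    - by apply/existsP; exists 1; apply/existsP; exists 2%:R.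
    - by apply/existsP; exists 0; apply/existsP; exists 2%:R.
    - by apply/existsP; exists 0; apply/existsP; exists 1.
  by have /existsP[j /existsP[l h]] := w3 i; exists j, l.
pose f w := (Num.floor (co j (word_rot c w) / g), Num.floor (co l (word_rot c w) / g)).
(* One word is kept per cell, and each word [w] is compared only with the representative [r w] of
   its cell. *)
have [W [r [uW WS injW rW]]] := representatives f S.
exists i, j, l, W; split=> //.
- by move=> w /WS /SP[].
- by move=> w /WS /SP[].
pose tq w := qcast R (quotient_word (r w, w)).
pose A w := qre (tq w) / M; pose B w := qdot c (tq w) / M.
pose dom w := B w ^+ 2 <= A w ^+ 2.
pose a w := if dom w then A w else B w.
pose b w := if dom w then B w else A w.
(* Two words with the same label form a pair counted by the energy, so Cauchy-Schwarz bounds the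
   number of labels from below, and with it [size W]. *)
pose lab w := (r w, (dom w, 0 <= a w), Num.floor (b w / g)).
have rS w : w \in S -> [/\ r w \in W, r w \in S & f (r w) = f w].
  by move=> /rW[h1 h2]; split=> //; apply: WS.
have tqN w : w \in S -> qnorm (tq w) = M ^+ 2.
  move=> hw; have [_ hr _] := rS _ hw; have [h _ _] := SP _ hw; have [h' _ _] := SP _ hr.
  by rewrite /tq /quotient_word /= qcastM qcastC qnormM qnormC !nwR.
have tqC w : w \in S ->
    qnorm (qsub (qmul (tq w) c) (qmul c (tq w))) <= 14 * g ^+ 2 * M ^+ 2.
  move=> hw; have [_ hr [e1 e2]] := rS _ hw.
  have [h bw sw] := SP _ hw; have [h' br sr] := SP _ hr.
  rewrite /tq /quotient_word /= qcastM qcastC (rotq_commutator _ (M := M)) ?nwR ?gt_eqF //.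
  rewrite mulrC ler_pM2r ?exprn_gt0 //.
  apply: (patch_close uni) => //; rewrite -/(word_rot c w) -/(word_rot c (r w)) ?nP //.
  + by apply: same_sign_mul; rewrite sw sr.
  + by rewrite distrC; apply: floor_close.
  + by rewrite distrC; apply: floor_close.
have AB w : w \in S -> A w ^+ 2 + B w ^+ 2 <= 1.
  move=> hw; have := qnorm_split (tq w) c0 c1; rewrite tqN //.
  have := qnorm_ge0 (qsub (qmul (tq w) c) (qmul c (tq w))).
  move=> h1 h2; rewrite !expr_div_n -mulrDl ler_pdivrMr ?exprn_gt0 //; lra.
have b1 w : w \in S -> `|b w| <= 1.
  move=> /AB h; have [hA hB] := (sqr_ge0 (A w), sqr_ge0 (B w)).
  rewrite -(@ler_pXn2r _ 2) ?nnegrE // real_normK ?num_real // expr1n.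
  rewrite /b; case: ifP => _; lra.
have labL : {in S, forall w, lab w \in
    [seq (wb, z) | wb <- [seq (w, e) | w <- W, e <- [seq (x, y) | x <- [:: true; false],
      y <- [:: true; false]]], z <- bin_range g]}.
  move=> w hw; apply: allpairs_f; last by apply: bin_rangeP => //; apply: b1.
  apply: allpairs_f; first by have [] := rS _ hw.
  by apply: allpairs_f; rewrite !inE; [case: (dom w)|case: (0 <= a w)].
have := size_collisions uS labL; rewrite !size_allpairs /=.
have -> : (2 * 2 = 4)%N by [].
have colE : (size (collisions lab S) <= E)%N.
  apply: leq_trans HE; rewrite /energy; apply: uniq_leq_size.
    exact: collisions_uniq.
  move=> [w v]; rewrite mem_collisions => /and3P[/eqP[er ed ea eb] wS vS].
  have [hw _ _] := SP _ wS; have [hv _ _] := SP _ vS.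
  have [_ /SP[hr _ _] _] := rS _ wS.
  rewrite mem_filter (@allpairs_f _ _ _ (fun w v => (w, v))) // andbT.
  have tv : tq v = qcast R (quotient_word (r w, v)) by rewrite /tq er.
  apply: (@near_real_quotient R _ (r w) _ _ g) => //; rewrite ?nw // -tv -/(tq w) -/M.
  apply: (@tube_close R c _ _ M g) => //; rewrite ?tqN ?tqC //.
  have MA (u : seq (quat int)) : A u * M = qre (tq u) by rewrite divfK // gt_eqF.
  have MB (u : seq (quat int)) : B u * M = qdot c (tq u) by rewrite divfK // gt_eqF.
  exists (a w * M), (b w * M), (a v * M), (b v * M).
  have abP u : b u ^+ 2 <= a u ^+ 2.
    by rewrite /a /b; case: ifP => // /negbT; rewrite -ltNge => /ltW.
  have aa : 0 <= a w * a v by apply: same_sign_mul.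
  have bb := floor_close g0 eb.
  have M2 : 0 <= M ^+ 2 by rewrite exprn_ge0 // ltW.
  split.
  + by rewrite /a /b -MA -MB; case: ifP => _; [left|right].
  + by rewrite /a /b -MA -MB; case: ifP => _; [left|right].
  + by rewrite -!MA -!MB /a /b ed; case: ifP => _ //; rewrite addrC.
  + split; rewrite ?exprMn ?ler_wpM2r //.
    by rewrite mulrACA mulr_ge0 // -expr2.
  + by rewrite -mulrBl normrM (gtr0_norm M0) ler_wpM2r // ltW.
move=> hL; have {}hL : (size S ^ 2 <= size W * 4 * size (bin_range g) * E)%N.
  by apply: leq_trans hL _; rewrite leq_mul2l colE orbT.
rewrite -natrX.
(* The constant 360 is [36 * 4 * (5 / 2)]: six classes squared, two bits of the label, and the bins
   of [b]. *)
have h6 : ((size G ^ (3 * nu)) ^ 2 <= 36 * (size W * 4 * size (bin_range g) * E))%N.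
  apply: (@leq_trans ((6 * size S) ^ 2)); first by rewrite leq_exp2r.
  by rewrite expnMn leq_mul2l hL orbT.
have := size_bin_range g0 g4; move: h6; rewrite -(ler_nat R) => h6 hb.
apply: (@le_trans _ _ ((36 * (size W * 4 * size (bin_range g) * E))%:R * g)).
  by rewrite ler_wpM2r // ltW.
rewrite !natrM; set x := (size W)%:R; set y := E%:R; set z := (size _)%:R in hb *.
have -> : 36 * (x * 4 * z * y) * g = 144 * (x * y) * (z * g) :> R by ring.
have -> : 360 * y * x = 144 * (x * y) * (5 / 2) :> R by field.
by rewrite ler_wpM2l // !mulr_ge0 // ler0n.
Qed.

End CoreCount.
End Bins.

(** * Rotations in coordinate triples *)

Section Rotations.
Variables (R : realType) (d : nat).
Implicit Types (x y : 'rV[R]_d) (f : {ffun 'I_3 -> 'I_d}) (q : quat R).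

Definition trip f x : quat R :=
  (0, x ord0 (f 0), x ord0 (f 1), x ord0 (f 2%:R)).

Definition rot f q x : 'rV[R]_d :=
  \row_i (if [pick a | f a == i] is Some a then co a (rotq q (trip f x))
          else x ord0 i).

Lemma co_trip f x a : co a (trip f x) = x ord0 (f a).
Proof.
by case: a => [[|[|[|//]]] h]; rewrite /co /trip /=; congr (x _ (f _)); apply: val_inj.
Qed.

Lemma rot_in f q x a : injective f -> rot f q x ord0 (f a) = co a (rotq q (trip f x)).
Proof.
move=> finj; rewrite mxE; case: pickP => [b /eqP/finj -> //|/(_ a)].
by rewrite eqxx.
Qed.

Lemma rot_out f q x i : i \notin codom f -> rot f q x ord0 i = x ord0 i.
Proof.
by move=> hi; rewrite mxE; case: pickP => // a /eqP h; rewrite -h codom_f in hi.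
Qed.

Lemma eq_co (c c' : quat R) : qre c = qre c' -> (forall a, co a c = co a c') -> c = c'.
Proof.
case: c c' => [[[? ?] ?] ?] [[[? ?] ?] ?]; rewrite /qre /= => -> h.
by move: (h 0) (h 1) (h 2%:R); rewrite /co /= => -> -> ->.
Qed.

Lemma trip_rot f q x : injective f -> trip f (rot f q x) = rotq q (trip f x).
Proof.
move=> finj; apply: eq_co; first by rewrite rotq_pure.
by move=> a; rewrite co_trip rot_in.
Qed.

Lemma eq_row f x y : (forall a, x ord0 (f a) = y ord0 (f a)) ->
  (forall i, i \notin codom f -> x ord0 i = y ord0 i) -> x = y.
Proof.
move=> h1 h2; apply/rowP => i.
by have [/codomP[a ->]|] := boolP (i \in codom f); [apply: h1 | apply: h2].
Qed.

Lemma rotM f q q' x : injective f -> rot f (qmul q q') x = rot f q (rot f q' x).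
Proof.
move=> finj; apply: (eq_row (f := f)) => [a|i hi]; last by rewrite !rot_out.
by rewrite !rot_in // trip_rot // rotqM.
Qed.

Lemma rot1 f x : injective f -> rot f q1 x = x.
Proof.
move=> finj; apply: (eq_row (f := f)) => [a|i hi]; last by rewrite rot_out.
rewrite rot_in // -co_trip; congr (co a _); rewrite /rotq qmul1l.
have -> : qconj (@q1 R) = q1 by rewrite /qconj /q1 oppr0.
by rewrite qmul1 qnorm1 invr1 qscal1.
Qed.

Lemma rotq_linear (k : R) q c c' :
  rotq q (qsub (qscal k c) c') = qsub (qscal k (rotq q c)) (rotq q c').
Proof.
rewrite /rotq; move: (qnorm q)^-1 => l.
move: q c c' => [[[? ?] ?] ?] [[[? ?] ?] ?] [[[? ?] ?] ?].
by rewrite /qsub /qscal /qmul /qconj; congr (_, _, _, _); ring.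
Qed.

Lemma co_scal (k : R) c (a : 'I_3) : co a (qscal k c) = k * co a c.
Proof. by move: c a => [[[? ?] ?] ?] [[|[|[|//]]] ?]. Qed.

Lemma trip_linear f (k : R) x y :
  trip f (k *: x - y) = qsub (qscal k (trip f x)) (trip f y).
Proof. by rewrite /trip /qsub /qscal !mxE mulr0 subr0. Qed.

Lemma row_linear (k : R) x y i : (k *: x - y) ord0 i = k * x ord0 i - y ord0 i.
Proof. by rewrite !mxE. Qed.

Lemma rot_linear f q (k : R) x y : injective f ->
  rot f q (k *: x - y) = k *: rot f q x - rot f q y.
Proof.
move=> finj; apply: (eq_row (f := f)) => [a|i hi]; rewrite row_linear.
  by rewrite !rot_in // trip_linear rotq_linear co_sub co_scal.
by rewrite !rot_out // row_linear.
Qed.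

Lemma sum3 (F : 'I_3 -> R) : \sum_a F a = F 0 + F 1 + F 2%:R.
Proof. by rewrite !big_ord_recl big_ord0 addr0 addrA; congr (_ + _ + _); congr F; apply: val_inj. Qed.

Lemma sum_codom (A : {pred 'I_d}) f (F : 'I_d -> R) : injective f ->
  (forall a, f a \in A) ->
  \sum_(i in A) F i = \sum_a F (f a) + \sum_(i in A | i \notin codom f) F i.
Proof.
move=> finj fA; rewrite (bigID (fun i => i \in codom f)) /=; congr (_ + _).
transitivity (\sum_(i in [set f a | a in [set: 'I_3]]) F i).
  apply: eq_bigl => i; apply/andP/imsetP => [[_ /codomP[a ->]]|[a _ ->]].
    by exists a; rewrite ?inE.
  by rewrite fA codom_f.
rewrite big_imset /=; last by move=> ? ? _ _; apply: finj.
by apply: eq_bigl => a; rewrite inE.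
Qed.

Lemma sum_rot (A : {pred 'I_d}) f q x : injective f -> (forall a, f a \in A) ->
  qnorm q != 0 ->
  \sum_(i in A) rot f q x ord0 i ^+ 2 = \sum_(i in A) x ord0 i ^+ 2.
Proof.
move=> finj fA q0; rewrite !(sum_codom _ finj fA); congr (_ + _); last first.
  by apply: eq_bigr => i /andP[_ hi]; rewrite rot_out.
have := qnorm_rotq (trip f x) q0; rewrite !(qnorm_pure (i := 0) (j := 1) (l := 2%:R)) //.
  by rewrite !sum3 !rot_in // => ->; rewrite !co_trip.
exact: rotq_pure.
Qed.

Variables (p m : nat) (G : seq (quat int)).
Hypothesis HG : free_alphabet p m G.

(** Orbits without the contraction, which [reach_closed] restores; the coordinate triple may change
    at every letter. *)
Fixpoint reach (n : nat) (x y : 'rV[R]_d) : Prop :=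
  if n is n'.+1 then exists f g z,
    [/\ injective (f : {ffun 'I_3 -> 'I_d}), g \in G, reach n' x z
      & y = rot f (qcast R g) z]
  else y = x.

Lemma reach_trans n n' x y z : reach n x y -> reach n' y z -> reach (n' + n) x z.
Proof.
elim: n' z => [|n' IH] z hxy /=; first by move=> ->.
by move=> [f [g [w [finj gG /(IH w hxy) hw ->]]]]; exists f, g, w.
Qed.

Lemma reach_word f w x : injective f -> all (mem G) w ->
  reach (size w) x (rot f (qcast R (qprod w)) x).
Proof.
move=> finj; elim: w => [|g w IH] /=; first by rewrite rot1.
move=> /andP[gG /IH h]; exists f, g, (rot f (qcast R (qprod w)) x); split => //.
by rewrite qcastM rotM.
Qed.

End Rotations.

(** * Freezing coordinates one at a time *)

Lemma size_le_sum (T : eqType) (s : seq T) (T' : T -> eqType) (t : forall x, seq (T' x))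
    (R : realType) (b : R) :
  {in s, forall x, b <= (size (t x))%:R} ->
  (size s)%:R * b <= (sumn [seq size (t x) | x <- s])%:R.
Proof.
elim: s => [|x s IH] h /=; first by rewrite mul0r.
rewrite -natr1 mulrDl mul1r natrD addrC lerD ?h ?mem_head //.
by apply: IH => y ys; rewrite h // inE ys orbT.
Qed.

Lemma injective_triple (d : nat) (A : {set 'I_d}) (i0 : 'I_d) : (2 < #|A|)%N -> i0 \in A ->
  exists f : {ffun 'I_3 -> 'I_d}, [/\ injective f, forall a, f a \in A & f 0 = i0].
Proof.
move=> A3 iA.
have c1 : (1 < #|A :\ i0|)%N by move: A3; rewrite (cardsD1 i0 A) iA.
have [i1 h1] : exists i, i \in A :\ i0 by apply/card_gt0P; apply: ltnW.
have c2 : (0 < #|(A :\ i0) :\ i1|)%N by move: c1; rewrite (cardsD1 i1 (A :\ i0)) h1.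
have [i2] := card_gt0P c2; move: h1; rewrite !inE => /andP[n1 A1] /and3P[n2 n2' A2].
pose F := nth i0 [:: i0; i1; i2].
exists [ffun a : 'I_3 => F a]; split.
- have u : uniq [:: i0; i1; i2].
    by rewrite /= !inE !negb_or eq_sym n1 eq_sym n2' eq_sym n2.
  by move=> a b; rewrite !ffunE => /eqP; rewrite nth_uniq // => /eqP/val_inj.
- by move=> [[|[|[|//]]] ?]; rewrite ffunE.
- by rewrite ffunE.
Qed.

(** The squared norm needed when [r] coordinates are still to be frozen: the triple is chosen to
    carry at least [1 / (r' + 4)] of it, and its dominant coordinate at least a third of that. *)
Fixpoint stage_norm (r : nat) : nat :=
  if r is r'.+1 then (3 * (r' + 4) * stage_norm r')%N else 1%N.

Lemma stage_norm_gt0 r : (0 < stage_norm r)%N.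
Proof. by elim: r => //= r IH; rewrite !muln_gt0 IH addn_gt0 orbT. Qed.

Section Stages.
Variables (R : realType) (d p m : nat) (G : seq (quat int)) (nu E : nat).
Hypothesis HG : free_alphabet p m G.
Hypothesis HE : (energy G (3 * nu) (near_real (8 * (m ^ nu) ^ 2)) <= E)%N.
Hypothesis E0 : (0 < E)%N.
Variables (h Rm : R).
Hypotheses (h0 : 0 < h) (h4 : h <= 1 / 4) (hq : h * (m ^ nu)%:R <= 1) (Rm1 : 1 <= Rm).

Let n := (3 * nu)%N.
Let beta : R := (size G ^ n)%:R ^+ 2 / (360 * E%:R).

(** For [h] near [1/q], [triple_count] is about [q^2], the cells of a sphere. [freeze_count] divides
    it by the at most [(5 / 2) * (Rm / h)] bins of one coordinate, leaving about [q] bins of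
    another. *)
Definition triple_count : R := beta * h / Rm.
Definition freeze_count : R := triple_count * (2 / 5) * (h / Rm).

Lemma triple_count_ge0 : 0 <= triple_count.
Proof.
have Rm0 : 0 <= Rm by apply: le_trans Rm1.
by rewrite /triple_count /beta !mulr_ge0 ?invr_ge0 ?exprn_ge0 ?mulr_ge0 ?(ltW h0).
Qed.

Lemma word_rot_scaled (f : {ffun 'I_3 -> 'I_d}) (x : 'rV[R]_d) (rho : R) w a :
  injective f -> rho != 0 ->
  rot f (qcast R (qprod w)) x ord0 (f a) =
    rho * co a (word_rot (qscal rho^-1 (trip f x)) w).
Proof.
move=> finj r0; rewrite rot_in // -co_scal; congr (co a _).
rewrite /word_rot /rotq qscalMr qscalMl !qscalA.
by congr qscal; rewrite mulrAC divff // mul1r.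
Qed.

(** This is [core_bins] for the triple scaled to length 1: cells of width [h] become cells of width
    [g = h / rho], with [h / Rm <= g <= h]. *)
Lemma triple_bins (f : {ffun 'I_3 -> 'I_d}) (x : 'rV[R]_d) : injective f ->
  1 <= qnorm (trip f x) -> qnorm (trip f x) <= Rm ^+ 2 ->
  exists i j l : 'I_3, exists W : seq (seq (quat int)),
  [/\ uniq [:: i; j; l], {subset W <= words G n} /\ uniq W,
      {in W, forall w, qnorm (trip f x) / 3 <= rot f (qcast R (qprod w)) x ord0 (f i) ^+ 2},
      {in W &, injective (fun w =>
         (Num.floor (rot f (qcast R (qprod w)) x ord0 (f j) / h),
          Num.floor (rot f (qcast R (qprod w)) x ord0 (f l) / h)))} &
      triple_count <= (size W)%:R /\ exists2 L : seq int,
        {in W, forall w, Num.floor (rot f (qcast R (qprod w)) x ord0 (f l) / h) \in L}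
        & (size L)%:R * (2 / 5) * (h / Rm) <= 1].
Proof.
move=> finj t1 tR; set T := qnorm (trip f x) in t1 tR *.
have Rm0 : 0 < Rm by apply: lt_le_trans Rm1.
pose rho := Num.sqrt T.
have rho2 : rho ^+ 2 = T by rewrite sqr_sqrtr // (le_trans _ t1).
have rho0 : 0 <= rho by apply: sqrtr_ge0.
have rho1 : 1 <= rho by rewrite -(@ler_pXn2r _ 2) ?nnegrE // rho2 expr1n.
have rhoR : rho <= Rm by rewrite -(@ler_pXn2r _ 2) ?nnegrE ?(ltW Rm0) // rho2.
have rp : 0 < rho by apply: lt_le_trans rho1.
have rn : rho != 0 by rewrite gt_eqF.
pose c := qscal rho^-1 (trip f x); pose g := h / rho.
have g0 : 0 < g by rewrite divr_gt0.
have gh : g <= h by rewrite ler_pdivrMr // ler_peMr // ltW.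
have nc : qnorm c = 1 by rewrite qnormZ -/T -rho2 exprVn mulVf // expf_neq0.
have pc : qre c = 0 by rewrite /c /qre /qscal /= mulr0.
have g4 : g <= 1 / 4 by apply: le_trans h4.
have gq : g * (m ^ nu)%:R <= 1.
  by apply: le_trans hq; rewrite ler_wpM2r.
have [i [j [l [W [uni WS hi [uW inj] hsz]]]]] := core_bins HG HE pc nc g0 g4 gq.
have fl w a : Num.floor (rot f (qcast R (qprod w)) x ord0 (f a) / h) =
    Num.floor (co a (word_rot c w) / g).
  rewrite (word_rot_scaled x w a finj rn) /g -/c; congr Num.floor.
  by rewrite invf_div; field; rewrite gt_eqF.
have gR : h / Rm <= g by rewrite ler_pM2l // lef_pV2.
exists i, j, l, W; split => //.
- move=> w wW; rewrite (word_rot_scaled x w i finj rn) exprMn rho2.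
  by rewrite ler_pM2l ?(lt_le_trans _ t1) // -[3^-1]mul1r; apply: hi.
- move=> w v wW vW; rewrite !fl; exact: inj.
split.
  rewrite /triple_count /beta -mulrA mulrAC ler_pdivrMr ?mulr_gt0 ?ltr0n //.
  rewrite [X in _ <= X]mulrC; apply: le_trans hsz.
  by rewrite ler_wpM2l // exprn_ge0.
exists (bin_range g).
  move=> w wW; rewrite fl; apply: bin_rangeP => //.
  have m0 : (0 < m)%N by case: HG => -[].
  have nw : qnorm (word_rot c w) = 1.
    rewrite qnorm_rotq // qnorm_cast (word_norm HG (WS _ wW)) intr_eq0.
    by rewrite eqz_nat -lt0n expn_gt0 m0.
  have := qnorm_pure uni (rotq_pure (qcast R (qprod w)) pc); rewrite -/(word_rot c w) nw.
  have := sqr_ge0 (co i (word_rot c w)); have := sqr_ge0 (co j (word_rot c w)).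
  move=> h1 h2 h3; rewrite -(@ler_pXn2r _ 2) ?nnegrE // real_normK ?num_real // expr1n.
  lra.
have := size_bin_range g0 g4.
have : (size (bin_range g))%:R * (h / Rm) <= (size (bin_range g))%:R * g.
  by rewrite ler_wpM2l.
lra.
Qed.

(* Freeze a coordinate [f j] of the rotated triple other than the dominant one, *)
(* so that the remaining coordinates keep a norm bounded below.                 *)
Lemma stage_count r (A : {set 'I_d}) (x : 'rV[R]_d) : #|A| = (r + 3)%N ->
  (stage_norm r)%:R <= \sum_(i in A) x ord0 i ^+ 2 ->
  \sum_(i in A) x ord0 i ^+ 2 <= Rm ^+ 2 ->
  exists Y : seq 'rV[R]_d, [/\ uniq Y,
    {in Y, forall y : 'rV[R]_d, reach G (r.+1 * n) x y /\ forall i, i \notin A -> y ord0 i = x ord0 i},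
    {in Y &, forall y y' : 'rV[R]_d, (forall i, i \in A ->
       Num.floor (y ord0 i / h) = Num.floor (y' ord0 i / h)) -> y = y'} &
    freeze_count ^+ r * triple_count <= (size Y)%:R].
Proof.
have nq w : w \in words G n -> qnorm (qcast R (qprod w)) != 0.
  have m0 : (0 < m)%N by case: HG => -[].
  move=> wW; rewrite qnorm_cast (word_norm HG wW) intr_eq0.
  by rewrite eqz_nat -lt0n expn_gt0 m0.
have rw (f : {ffun 'I_3 -> 'I_d}) y w : injective f -> w \in words G n ->
    reach G n y (rot f (qcast R (qprod w)) y).
  by move=> finj /wordsP[<- aw]; apply: reach_word.
elim: r A x => [|r IH] A x cA lo hi.
  have [i0 iA] : exists i, i \in A by apply/card_gt0P; rewrite cA.
  have [|f [finj fA _]] := @injective_triple d A i0 _ iA; first by rewrite cA.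
  have tE : qnorm (trip f x) = \sum_(i in A) x ord0 i ^+ 2.
    rewrite (sum_codom _ finj fA) [X in _ + X]big1 ?addr0; last first.
      move=> i /andP[iA' /negP[]].
      have -> : (i \in codom f) = (i \in [set f a | a in [set: 'I_3]]).
        by apply/codomP/imsetP => [[a ->]|[a _ ->]]; [exists a; rewrite ?inE|exists a].
      suff -> : [set f a | a in [set: 'I_3]] = A by [].
      apply/eqP; rewrite eqEcard cA card_imset // cardsT card_ord leqnn andbT.
      by apply/subsetP => _ /imsetP[a _ ->].
    by rewrite sum3 (qnorm_pure (i := 0) (j := 1) (l := 2%:R)) // !co_trip.
  rewrite -tE in lo hi.
  have [i [j [l [W [uni [WS uW] _ inj [hW _]]]]]] := triple_bins finj lo hi.
  pose F w := rot f (qcast R (qprod w)) x.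
  have binj : {in W &, forall w v, (forall i, i \in A ->
      Num.floor (F w ord0 i / h) = Num.floor (F v ord0 i / h)) -> w = v}.
    by move=> w v wW vW e; apply: inj => //; rewrite !e.
  exists (map F W); split.
  - by rewrite map_inj_in_uniq // => w v wW vW e; apply: binj => // a _; rewrite e.
  - move=> _ /mapP[w wW ->]; split; first by rewrite mul1n; apply: rw => //; apply: WS.
    move=> a aA; rewrite /F rot_out //; apply: contra aA => /codomP[b ->]; exact: fA.
  - by move=> _ _ /mapP[w wW ->] /mapP[v vW ->] /(binj _ _ wW vW) ->.
  - by rewrite expr0 mul1r size_map.
(* A triple through the largest of the [r + 4] coordinates has norm large enough for the next
   stage. *)
have [i0 [iA hi0]] : exists i0, i0 \in A /\
    \sum_(i in A) x ord0 i ^+ 2 <= (r + 4)%:R * x ord0 i0 ^+ 2.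
  have [k kA] : exists i, i \in A by apply/card_gt0P; rewrite cA.
  case: (@arg_maxP _ _ _ k (mem A) (fun i => x ord0 i ^+ 2) kA) => i1 i1A hmax.
  exists i1; split => //.
  apply: (@le_trans _ _ (\sum_(i in A) x ord0 i1 ^+ 2)); first exact: ler_sum.
  by rewrite sumr_const cA -[(_ *+ _)]mulr_natl addSnnS.
have [|f [finj fA f0]] := @injective_triple d A i0 _ iA; first by rewrite cA addnC.
have tE : qnorm (trip f x) = \sum_a x ord0 (f a) ^+ 2.
  by rewrite sum3 (qnorm_pure (i := 0) (j := 1) (l := 2%:R)) // !co_trip.
have tle : qnorm (trip f x) <= \sum_(i in A) x ord0 i ^+ 2.
  by rewrite tE (sum_codom _ finj fA) lerDl sumr_ge0 // => i _; apply: sqr_ge0.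
have tge : 3 * (stage_norm r)%:R <= qnorm (trip f x).
  have : x ord0 i0 ^+ 2 <= qnorm (trip f x).
    by rewrite tE sum3 f0 -addrA lerDl addr_ge0 ?sqr_ge0.
  apply: le_trans; have r4 : 0 < (r + 4)%:R :> R by rewrite ltr0n addn_gt0 orbT.
  rewrite -(ler_pM2l r4); apply: le_trans hi0; apply: le_trans lo.
  by rewrite /= !natrM mulrA [(r + 4)%:R * _]mulrC.
have s1 : 1 <= (stage_norm r)%:R :> R by rewrite ler1n stage_norm_gt0.
have t1 : 1 <= qnorm (trip f x) by lra.
have [i [j [l [W [uni [WS uW] hnorm inj [hW [L hL sL]]]]]]] :=
  triple_bins finj t1 (le_trans tle hi).
pose F w := rot f (qcast R (qprod w)) x.
pose bj w := Num.floor (F w ord0 (f j) / h).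
(* One word per bin of the coordinate to be frozen; such a bin holds at most [size L] words of [W],
   told apart by the bin of [f l]. *)
have [W' [rr [uW' WW' injW' hrr]]] := representatives bj W.
have szW : freeze_count <= (size W')%:R.
  have : (size W <= size W' * size L)%N.
    rewrite -(size_map bj W'); apply: (size_le_fibers (f := bj)).
      by move=> w /hrr[h1 h2]; rewrite -h2 map_f.
    move=> u _; apply: (@size_le_inj _ _ (fun w => Num.floor (F w ord0 (f l) / h))).
    - exact: filter_uniq.
    - move=> w v; rewrite !mem_filter => /andP[/eqP h1 wW] /andP[/eqP h2 vW] e.
      by apply: inj => //; rewrite -/(F w) -/(F v) e -/(bj w) -/(bj v) h1 h2.
    - by move=> w; rewrite mem_filter => /andP[_ /hL].
  rewrite -(ler_nat R) natrM => h1.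
  have Rm0 : 0 < Rm by apply: lt_le_trans Rm1.
  have c0 : 0 <= 2 / 5 * (h / Rm) by rewrite mulr_ge0 // divr_ge0 ?ltW.
  rewrite /freeze_count -mulrA.
  apply: (@le_trans _ _ ((size W')%:R * (size L)%:R * (2 / 5 * (h / Rm)))).
    by apply: ler_wpM2r => //; apply: le_trans h1.
  by rewrite -mulrA ler_piMr // mulrA.
pose A' := A :\ f j.
have cA' : #|A'| = (r + 3)%N.
  by move: cA; rewrite (cardsD1 (f j) A) fA add1n addSn => -[].
have ij : f i \in A'.
  rewrite !inE fA andbT; apply/eqP => /finj e; move: uni; rewrite e /= inE eqxx //.
have hY w : exists Y : seq 'rV[R]_d, w \in W' -> [/\ uniq Y,
    {in Y, forall y : 'rV[R]_d, reach G (r.+1 * n) (F w) y /\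
       forall i, i \notin A' -> y ord0 i = F w ord0 i},
    {in Y &, forall y y' : 'rV[R]_d, (forall i, i \in A' ->
       Num.floor (y ord0 i / h) = Num.floor (y' ord0 i / h)) -> y = y'} &
    freeze_count ^+ r * triple_count <= (size Y)%:R].
  have [wW'|] := boolP (w \in W'); last by exists [::].
  have wW := WW' _ wW'.
  have [||Y hY] := IH A' (F w) cA'; last by exists Y.
  - apply: (@le_trans _ _ (qnorm (trip f x) / 3)); first by rewrite ler_pdivlMr // mulrC.
    apply: le_trans (hnorm _ wW) _; rewrite (bigD1 (f i)) //= lerDl.
    by rewrite sumr_ge0 // => a _; apply: sqr_ge0.
  - apply: le_trans hi; rewrite -(sum_rot x finj fA (nq _ (WS _ wW))) -/(F w).
    rewrite [X in _ <= X](big_setD1 (f j)) //=.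
    by rewrite lerDr sqr_ge0.
have {hY} [Y hY] := choice hY.
(* Later stages act inside [A'] and keep coordinate [f j], so families from different [w] stay in
   different bins. *)
pose Z := [seq y | w <- W', y <- Y w].
have zP z : z \in Z -> exists2 w, w \in W' & z \in Y w.
  by case/allpairsPdep=> w [y [h1 h2 ->]]; exists w.
have binF w z : w \in W' -> z \in Y w ->
    Num.floor (z ord0 (f j) / h) = bj w.
  move=> wW' zY; have [_ h1 _ _] := hY _ wW'; have [_ ->//] := h1 _ zY.
  by rewrite !inE eqxx.
have same w z w' z' : w \in W' -> z \in Y w -> w' \in W' -> z' \in Y w' ->
    Num.floor (z ord0 (f j) / h) = Num.floor (z' ord0 (f j) / h) -> w = w'.
  by move=> h1 h2 h3 h4'; rewrite (binF w) // (binF w') //; apply: injW'.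
exists Z; split.
- apply: allpairs_uniq_dep => //; first by move=> w wW'; case: (hY _ wW').
  move=> _ _ /allpairsPdep[w [y [h1 h2 ->]]] /allpairsPdep[w' [y' [h1' h2' ->]]] /= e.
  have ww : w = w' by apply: (same w y w' y') => //; rewrite e.
  by rewrite ww e.
- move=> z /zP[w wW' zY]; have [_ h1 _ _] := hY _ wW'; have [h2 h3] := h1 _ zY.
  split; first by rewrite mulSn addnC; apply: reach_trans h2; apply/rw => //; apply/WS/WW'.
  move=> a aA; rewrite h3; last by rewrite !inE (negPf aA) andbF.
  rewrite /F rot_out //; apply: contra aA => /codomP[b ->]; exact: fA.
- move=> z z' /zP[w wW' zY] /zP[w' wW'' zY'] e.
  have ww : w = w' by apply: (same w z w' z') => //; apply: e.
  rewrite -ww in zY'; have [_ _ h1 _] := hY _ wW'; apply: h1 => // a.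
  by rewrite !inE => /andP[_ /e].
- rewrite size_allpairs_dep exprS -mulrA.
  have nn : 0 <= freeze_count ^+ r * triple_count.
    have t0 := triple_count_ge0.
    have Rm0 : 0 <= Rm by apply: le_trans Rm1.
    have hR : 0 <= h / Rm by rewrite divr_ge0 // ltW.
    have h25 : 0 <= 2 / 5 :> R by lra.
    apply: mulr_ge0 => //; apply: exprn_ge0; apply: mulr_ge0 => //.
    exact: mulr_ge0.
  apply: le_trans (ler_wpM2r nn szW) _.
  apply: size_le_sum => w wW'; by have [] := hY _ wW'.
Qed.

End Stages.

(** * Counting the orbits *)

From mathcomp Require Import all_classical all_reals all_analysis.
Import numFieldNormedType.Exports.

(** The two losses of [m ^ (e1 * nu)] are the divisor factor, at most [m ^ (18 * nu / kap)] up to a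
    constant, with [kap >= 18 / e1], and the factor [(8 * c ^ 6) ^ nu]. The latter covers
    [(3 * nu).+1] and the density of the alphabet, and is absorbed by taking
    [m ^ e1 >= 8 * c ^ 6]. *)
Lemma word_energy (R : realType) (e1 : R) : 0 < e1 ->
  exists p m G, [/\ free_alphabet p m G, (4 < m)%N & exists b : R, forall nu,
    exists E, [/\ (0 < E)%N,
      (energy G (3 * nu) (near_real (8 * (m ^ nu) ^ 2)) <= E)%N &
      expR (3 * nu%:R * ln m%:R - 2 * nu%:R * e1 * ln m%:R - b) <=
        (size G ^ (3 * nu))%:R ^+ 2 / (360 * E%:R)]].
Proof.
move=> e10; have [c c0 hc] := free_alphabet_exists.
pose C0 : R := (8 * c ^ 6)%:R.
have C0p : 0 < C0 by rewrite ltr0n muln_gt0 expn_gt0 c0.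
have [p [m [G [HG Pm Gm mG]]]] := hc ((Num.truncn (C0 `^ e1^-1)).+1 + 4)%N.
exists p, m, G; split=> //; first by apply: leq_ltn_trans Pm; rewrite leq_addl.
have m1 : (1 < m)%N by move: Pm; clear; lia.
have m0 : 0 < m%:R :> R by rewrite ltr0n ltnW.
set L : R := ln m%:R.
have L0 : 0 < L by rewrite ln_gt0 // ltr1n.
have mE : m%:R = expR L :> R by rewrite lnK // posrE.
have C0e : C0 <= expR (e1 * L).
  rewrite -[C0]lnK ?posrE // ler_expR mulrC -ler_pdivrMr //.
  rewrite -ler_expR -mE.
  have -> : expR (ln C0 / e1) = C0 `^ e1^-1 by rewrite /powR gt_eqF // mulrC.
  have /ltW/le_trans : C0 `^ e1^-1 < (Num.truncn (C0 `^ e1^-1)).+1%:R.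
    by have /andP[] := truncn_itv (powR_ge0 C0 e1^-1).
  apply; rewrite ler_nat; apply: ltnW; apply: leq_ltn_trans Pm; exact: leq_addr.
pose kap := (Num.truncn (18 / e1)).+1.
have kapE : 18 <= kap%:R * e1.
  rewrite -ler_pdivrMr //; apply: ltW.
  have /truncn_itv/andP[] : 0 <= 18 / e1 by rewrite divr_ge0 // ltW.
  by [].
have [K K0 hK] := divisor_bound_square (ltn0Sn (Num.truncn (18 / e1)) : (0 < kap)%N).
have [a [a0 aE]] : exists a : R, 0 < a /\ a = 1105%:R by exists 1105; split; [lra|].
have [b [b0 bE]] : exists b : R, 0 < b /\ b = 360 by exists 360; split; [lra|].
pose C1 : R := b * a * K%:R.
have C1p : 0 < C1 by rewrite !mulr_gt0 // ltr0n.
rewrite -bE.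
exists (ln C1) => nu.
have M0 : (0 < m ^ (3 * nu))%N by rewrite expn_gt0 ltnW.
have [Rn [Rn0 hRn hRk]] := hK _ M0.
exists ((3 * nu).+1 * (1105 * (m ^ nu) ^ 3 * Rn))%N.
have q0 : (0 < m ^ nu)%N by rewrite expn_gt0 ltnW.
have E0 : (0 < (3 * nu).+1 * (1105 * (m ^ nu) ^ 3 * Rn))%N.
  have q30 : (0 < (m ^ nu) ^ 3)%N by rewrite expn_gt0 q0.
  by rewrite muln_gt0 /= muln_gt0 Rn0 andbT muln_gt0 q30 andbT.
split=> //; first exact: energy_near_real HG Gm Rn0 hRn.
have RnE : Rn%:R <= K%:R * expR (nu%:R * (e1 * L)).
  rewrite -(@ler_pXn2r _ kap) ?nnegrE ?mulr_ge0 ?expR_ge0 // exprMn.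
  apply: (@le_trans _ _ (K * (m ^ (3 * nu)) ^ 6)%N%:R).
    by rewrite -natrX ler_nat.
  rewrite natrM; apply: ler_pM => //.
    by rewrite -natrX ler_nat -{1}(expn1 K) leq_pexp2l.
  rewrite -expnM natrX mE -!expRM_natl ler_expR.
  have -> : kap%:R * (nu%:R * (e1 * L)) = (kap%:R * e1) * (nu%:R * L) by ring.
  have -> : (3 * nu * 6)%:R * L = 18 * (nu%:R * L) by rewrite !natrM; ring.
  by rewrite ler_wpM2r // mulr_ge0 // ltW.
have n8 : ((3 * nu).+1 <= 8 ^ nu)%N.
  elim: (nu) => // n; rewrite expnS; move: (8 ^ n)%N => u; clear; lia.
move: E0; set E := ((3 * nu).+1 * _)%N => E0.
have EE : E%:R <= (8 ^ nu)%:R * (a * expR (3 * nu%:R * L)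
    * (K%:R * expR (nu%:R * (e1 * L)))).
  have -> : E%:R = ((3 * nu).+1)%:R * (a * ((m ^ nu) ^ 3)%:R * Rn%:R) :> R.
    by rewrite /E natrM natrM natrM aE.
  apply: ler_pM; [exact: ler0n| |by rewrite ler_nat|].
    by apply: mulr_ge0; [apply: mulr_ge0; [exact: ltW|exact: ler0n]|exact: ler0n].
  apply: ler_pM => //; first by apply: mulr_ge0; [exact: ltW|exact: ler0n].
  rewrite ler_pM2l //.
  rewrite -expnM natrX mE -expRM_natl natrM.
  by have -> : nu%:R * 3 * L = 3 * nu%:R * L by ring.
clearbody E.
rewrite ler_pdivlMr; last by rewrite mulr_gt0 // ltr0n.
have kE : expR (6 * nu%:R * L) <= (c ^ (6 * nu))%:R * (size G ^ (3 * nu))%:R ^+ 2.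
  have -> : 6 * nu%:R * L = (6 * nu)%:R * L by rewrite natrM.
  rewrite expRM_natl -mE -!natrX -natrM ler_nat -expnM.
  have -> : (3 * nu * 2 = 6 * nu)%N by rewrite mulnAC.
  by rewrite -expnMn; case: (6 * nu)%N => // k; rewrite leq_exp2r.
rewrite expRD (expRN (ln C1)) lnK ?posrE // expRD.
have pc : 0 < (c ^ (6 * nu))%:R :> R by rewrite ltr0n expn_gt0 c0.
rewrite -(ler_pM2l pc); apply: le_trans kE.
have c8 : (8 ^ nu)%:R * (c ^ (6 * nu))%:R <= expR (nu%:R * (e1 * L)).
  by rewrite expRM_natl -natrM expnM -expnMn natrX lerXn2r // nnegrE ?expR_ge0 // ltW.
set x := expR (3 * nu%:R * L) in EE *.
set y := expR (nu%:R * (e1 * L)) in EE c8 *.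
have -> : expR (6 * nu%:R * L) = x * x by rewrite -expRD; congr expR; ring.
have -> : expR (- (2 * nu%:R * e1 * L)) = (y * y)^-1.
  by rewrite -expRD -expRN; congr expR; ring.
have [x0 y0] : 0 < x /\ 0 < y by rewrite !expR_gt0.
apply: (@le_trans _ _ ((c ^ (6 * nu))%:R * (x / (y * y) / C1 *
   (b * ((8 ^ nu)%:R * (a * x * (K%:R * y))))))).
  rewrite ler_pM2l // ler_pM2l; last first.
    by apply: divr_gt0 => //; apply: divr_gt0 => //; apply: mulr_gt0.
  by rewrite ler_pM2l.
have -> : (c ^ (6 * nu))%:R * (x / (y * y) / C1 *
    (b * ((8 ^ nu)%:R * (a * x * (K%:R * y))))) =
    ((8 ^ nu)%:R * (c ^ (6 * nu))%:R) * (x * x) / y.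
  rewrite /C1; field; rewrite ?gt_eqF //= ltr0n //.
by rewrite ler_pdivrMr // mulrC ler_wpM2l // mulr_ge0 // ltW.
Qed.

Lemma orbit_count (R : realType) (r p m : nat) (G : seq (quat int)) (e1 b : R) :
  free_alphabet p m G -> (4 < m)%N ->
  (forall nu, exists E, [/\ (0 < E)%N,
      (energy G (3 * nu) (near_real (8 * (m ^ nu) ^ 2)) <= E)%N &
      expR (3 * nu%:R * ln m%:R - 2 * nu%:R * e1 * ln m%:R - b) <=
        (size G ^ (3 * nu))%:R ^+ 2 / (360 * E%:R)]) ->
  exists b' : R, forall nu (h : R) (x : 'rV[R]_(r + 3)), (0 < nu)%N ->
    expR (- (nu%:R + 1 + e1) * ln m%:R) <= h -> h <= expR (- nu%:R * ln m%:R) ->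
    \sum_i x ord0 i ^+ 2 = (stage_norm r)%:R ->
    exists Y : seq 'rV[R]_(r + 3), [/\ uniq Y,
      {in Y, forall y : 'rV[R]_(r + 3), reach G (r.+1 * (3 * nu)) x y},
      {in Y &, forall y y' : 'rV[R]_(r + 3), (forall i,
         Num.floor (y ord0 i / h) = Num.floor (y' ord0 i / h)) -> y = y'} &
      expR ((r%:R + 2 - 2 * (r%:R + 1) * e1) * (nu%:R * ln m%:R) - b')
        <= (size Y)%:R].
Proof.
move=> HG m4 HE; set L : R := ln m%:R.
have m0 : 0 < m%:R :> R by rewrite ltr0n; apply: leq_ltn_trans m4.
have mE : m%:R = expR L :> R by rewrite lnK // posrE.
have L0 : 0 < L by rewrite ln_gt0 // ltr1n; apply: leq_ltn_trans m4.
pose Rm : R := Num.sqrt (stage_norm r)%:R.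
have s1 : 1 <= (stage_norm r)%:R :> R by rewrite ler1n stage_norm_gt0.
have Rm2 : Rm ^+ 2 = (stage_norm r)%:R by rewrite sqr_sqrtr // ler0n.
have Rm1 : 1 <= Rm by rewrite -(@ler_pXn2r _ 2) ?nnegrE ?sqrtr_ge0 // Rm2 expr1n.
have Rm0 : 0 < Rm by apply: lt_le_trans Rm1.
pose b2 := (1 + e1) * L + ln Rm; pose b3 : R := ln (5 / 2).
exists (r%:R * (b + b2 + b3 + b2) + (b + b2)) => nu h x nu0 hlo hhi hx.
have [E [E0 hE hbeta]] := HE nu.
have h0 : 0 < h by apply: lt_le_trans hlo; apply: expR_gt0.
have qE : (m ^ nu)%:R = expR (nu%:R * L) :> R by rewrite natrX mE -expRM_natl.
have h4 : h <= 1 / 4.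
  apply: le_trans hhi _; rewrite mulNr expRN -qE div1r lef_pV2 ?posrE //; last first.
    by rewrite ltr0n expn_gt0 (leq_ltn_trans _ m4).
  rewrite (ler_nat R 4); apply: leq_trans (ltnW m4) _.
  by rewrite -{1}(expn1 m) leq_pexp2l // (leq_ltn_trans _ m4).
have hq : h * (m ^ nu)%:R <= 1.
  rewrite qE; apply: (@le_trans _ _ (expR (- nu%:R * L) * expR (nu%:R * L))).
    by rewrite ler_wpM2r // expR_ge0.
  by rewrite -expRD mulNr addNr expR0.
have hR : expR (- nu%:R * L - b2) <= h / Rm.
  have -> : - nu%:R * L - b2 = - (nu%:R + 1 + e1) * L - ln Rm by rewrite /b2; ring.
  rewrite expRD expRN lnK ?posrE // ler_pM2r ?invr_gt0 //.
have ht : expR (2 * nu%:R * L - 2 * nu%:R * e1 * L - b - b2) <=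
    triple_count G nu E h Rm.
  rewrite /triple_count -[X in _ <= X]mulrA.
  have -> : 2 * nu%:R * L - 2 * nu%:R * e1 * L - b - b2 =
    (3 * nu%:R * L - 2 * nu%:R * e1 * L - b) + (- nu%:R * L - b2) by ring.
  by rewrite expRD; apply: ler_pM; rewrite ?expR_ge0.
have hf : expR (nu%:R * L - 2 * nu%:R * e1 * L - b - b2 - b3 - b2) <=
    freeze_count G nu E h Rm.
  rewrite /freeze_count.
  have -> : nu%:R * L - 2 * nu%:R * e1 * L - b - b2 - b3 - b2 =
    ((2 * nu%:R * L - 2 * nu%:R * e1 * L - b - b2) - b3) + (- nu%:R * L - b2) by ring.
  have b3E : expR (- b3) = 2 / 5.
    by rewrite expRN lnK ?posrE ?invf_div //; lra.
  rewrite expRD; apply: ler_pM; rewrite ?expR_ge0 //.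
  by rewrite expRD b3E ler_pM2r //; lra.
have cA : #|[set: 'I_(r + 3)]| = (r + 3)%N by rewrite cardsT card_ord.
have sT : \sum_(i in [set: 'I_(r + 3)]) x ord0 i ^+ 2 = (stage_norm r)%:R.
  by rewrite -hx; apply: eq_bigl => i; rewrite inE.
have [||Y [uY rY iY sY]] := stage_count HG hE E0 h0 h4 hq Rm1 cA (x := x).
- by rewrite sT.
- by rewrite sT Rm2.
exists Y; split=> //.
- by move=> y /rY[].
- by move=> y y' yY yY' e; apply: iY.
apply: le_trans sY.
have -> : (r%:R + 2 - 2 * (r%:R + 1) * e1) * (nu%:R * L) -
    (r%:R * (b + b2 + b3 + b2) + (b + b2)) =
  r%:R * (nu%:R * L - 2 * nu%:R * e1 * L - b - b2 - b3 - b2) +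
  (2 * nu%:R * L - 2 * nu%:R * e1 * L - b - b2) by ring.
rewrite expRD expRM_natl; apply: ler_pM; rewrite ?expR_ge0 ?exprn_ge0 ?expR_ge0 //.
by apply: lerXn2r; rewrite ?nnegrE ?expR_ge0 // (le_trans _ hf) // expR_ge0.
Qed.

(** * Attractors and box dimension *)

Local Open Scope classical_set_scope.

Section Linear.
Variables (R : realType) (d : nat).
Implicit Types (x y : 'rV[R]_d) (f : {ffun 'I_3 -> 'I_d}).

Lemma rot_sub f q x y : injective f -> rot f q (x - y) = rot f q x - rot f q y.
Proof. by move=> finj; have := rot_linear q 1 x y finj; rewrite !scale1r. Qed.

Lemma rot_scale f q (k : R) x : injective f -> rot f q (k *: x) = k *: rot f q x.
Proof.
move=> finj; have := rot_linear q k x 0 finj; rewrite subr0.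
have -> : rot f q (0 : 'rV[R]_d) = 0.
  by rewrite -[0 in LHS](subrr (0 : 'rV[R]_d)) rot_sub // subrr.
by rewrite subr0.
Qed.

End Linear.

Section System.
Variables (R : realType) (d : nat) (p m : nat) (G : seq (quat int)) (lam : R).
Hypothesis HG : free_alphabet p m G.
Hypotheses (lam0 : 0 < lam) (lam1 : lam < 1).

(** A non-injective [f] gives a plain homothety, so that all functions [f] can serve as indices. *)
Definition gen (f : {ffun 'I_3 -> 'I_d}) (g : quat int) (x : 'rV[R]_d) : 'rV[R]_d :=
  lam *: (if injectiveb f then rot f (qcast R g) x else x).

Lemma sqdistE (x y : 'rV[R]_d) : sqdist x y = \sum_i (x - y) ord0 i ^+ 2.
Proof. by apply: eq_bigr => i _; rewrite !mxE. Qed.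

Lemma gen_similarity f g : g \in G -> contracting_similarity (gen f g).
Proof.
move=> gG; exists lam; split=> //; split=> // x y.
have m0 : (0 < m)%N by case: HG => -[].
have gn : qnorm (qcast R g) != 0.
  by case: HG => _ _ /(_ _ gG) h _ _; rewrite qnorm_cast h intr_eq0 eqz_nat -lt0n.
have key (u v : 'rV[R]_d) :
    sqdist (lam *: u) (lam *: v) = lam ^+ 2 * sqdist u v.
  rewrite !sqdistE -scalerBr mulr_sumr; apply: eq_bigr => i _.
  by rewrite mxE exprMn.
rewrite /gen; case: ifP => [/injectiveP finj|_]; rewrite key //; congr (_ * _).
rewrite !sqdistE -rot_sub //.
by have := sum_rot (A := predT) (x - y) finj (fun=> isT) gn.
Qed.

Lemma gen0 f g : gen f g 0 = 0.
Proof.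
rewrite /gen; case: ifP => [/injectiveP finj|_]; last by rewrite scaler0.
by rewrite -[0 in LHS](subrr 0) rot_sub // subrr scaler0.
Qed.

Lemma sum_gen f g x : g \in G ->
  \sum_i gen f g x ord0 i ^+ 2 = lam ^+ 2 * \sum_i x ord0 i ^+ 2.
Proof.
move=> gG; have [r [_ [_ h]]] := gen_similarity f gG.
have m0 : (0 < m)%N by case: HG => -[].
have gn : qnorm (qcast R g) != 0.
  by case: HG => _ _ /(_ _ gG) h' _ _; rewrite qnorm_cast h' intr_eq0 eqz_nat -lt0n.
rewrite mulr_sumr /gen; case: ifP => [/injectiveP finj|_]; last first.
  by apply: eq_bigr => i _; rewrite mxE exprMn.
under eq_bigr do rewrite mxE exprMn.
rewrite -!mulr_sumr; congr (_ * _).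
exact: (sum_rot (A := predT) x finj (fun=> isT) gn).
Qed.

Section Homogeneous.
Variable I : finType.
Variable S : I -> 'rV[R]_d -> 'rV[R]_d.
Hypothesis HS : forall i, exists f g, g \in G /\ S i = gen f g.

Lemma attractor_origin : (0 < #|I|)%N -> is_inhom_attractor S set0 [set (0 : 'rV[R]_d)].
Proof.
move=> /card_gt0P[i0 _]; split; first by exists 0.
split; first exact: compact_set1.
rewrite setU0; apply/seteqP; split => x.
  move=> ->; exists i0 => //; exists 0 => //.
  by have [f [g [_ ->]]] := HS i0; rewrite gen0.
by case=> i _ [_ -> <-]; have [f [g [_ ->]]] := HS i; rewrite gen0.
Qed.

(** The supremum [s] of the squared norm on [F] satisfies [s <= lam ^ 2 * s], hence [s <= 0]. *)
Lemma attractor_unique F : is_inhom_attractor S set0 F -> F = [set (0 : 'rV[R]_d)].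
Proof.
move=> [[x0 Fx0] [cF FE]]; rewrite setU0 in FE.
pose N (x : 'rV[R]_d) := \sum_i x ord0 i ^+ 2.
have N0 x : 0 <= N x by apply: sumr_ge0 => i _; apply: sqr_ge0.
pose V : set R := [set N x | x in F].
have V0 : V !=set0 by exists (N x0); exists x0.
have ubV : has_ubound V.
  have [M [_ hM]] := compact_bounded cF.
  have {hM}hM x : F x -> `|x| <= M + 1 by apply: (hM (M + 1)); rewrite ltrDl.
  exists (\sum_(i < d) (M + 1) ^+ 2) => _ [x Fx <-]; apply: ler_sum => i _.
  have M10 : 0 <= M + 1 by apply: le_trans (hM _ Fx).
  apply: sqr_bound => //; apply: le_trans (hM _ Fx).
  rewrite [X in _ <= X]mx_normrE.
  exact: (le_bigmax _ (fun ij : 'I_1 * 'I_d => `|x ij.1 ij.2|) (ord0, i)).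
have hN x : F x -> N x <= lam ^+ 2 * sup V.
  rewrite {1}FE => -[i _ [y Fy <-]]; have [f [g [gG ->]]] := HS i.
  rewrite /N sum_gen // ler_pM2l ?exprn_gt0 //.
  by apply: ub_le_sup => //; exists y.
have supV : sup V <= lam ^+ 2 * sup V.
  by apply: ge_sup => // _ [x Fx <-]; apply: hN.
have l2 : lam ^+ 2 < 1 by rewrite expr_lt1 // ltW.
have sV0 : sup V <= 0.
  rewrite leNgt; apply/negP => h.
  by move: supV; rewrite leNgt; case/negP; rewrite -subr_gt0 -[X in X - _]mul1r -mulrBl mulr_gt0 // subr_gt0.
have F0 x : F x -> x = 0.
  move=> Fx; have : N x <= 0 by apply: le_trans sV0; apply: ub_le_sup => //; exists x.
  move=> h; apply/rowP => i; rewrite mxE.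
  have /eqP : N x = 0 by apply/eqP; rewrite eq_le h N0.
  rewrite psumr_eq0 => [/allP/(_ i)|j _]; last exact: sqr_ge0.
  by rewrite mem_index_enum sqrf_eq0 => /(_ isT)/eqP.
apply/seteqP; split => x; first exact: F0.
by move=> ->; rewrite -(F0 _ Fx0).
Qed.

End Homogeneous.

Lemma reach_closed (F : set 'rV[R]_d) : (forall f g x, g \in G -> F x -> F (gen f g x)) ->
  forall n (k : R) x y, reach G n x y -> F (k *: x) -> F ((lam ^+ n * k) *: y).
Proof.
move=> hF; elim=> [|n IH] k x y /=; first by move=> ->; rewrite mul1r.
move=> [f [g [z [finj gG hz ->]]]] Fx.
have := hF f g _ gG (IH _ _ _ hz Fx).
rewrite /gen; have -> : injectiveb f by apply/injectiveP.
by rewrite rot_scale // scalerA exprS mulrA.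
Qed.

End System.

(** Scaling by [k] turns cells of width [delta / k] into [delta]-mesh cubes. *)
Lemma N_mesh_ge (R : realType) (d : nat) (delta k : R) (E : set 'rV[R]_d)
    (Y : seq 'rV[R]_d) : 0 < delta -> 0 < k -> uniq Y ->
  {in Y, forall y : 'rV[R]_d, E (k *: y)} ->
  {in Y &, forall y y' : 'rV[R]_d, (forall i,
     Num.floor (y ord0 i / (delta / k)) = Num.floor (y' ord0 i / (delta / k))) -> y = y'} ->
  ((size Y)%:R%:E <= N_mesh delta E)%E.
Proof.
move=> d0 k0 uY hE inj.
pose cell (y : 'rV[R]_d) : 'rV[int]_d := \row_i Num.floor (y ord0 i / (delta / k)).
have uc : uniq (map cell Y).
  rewrite map_inj_in_uniq // => y y' yY yY' e; apply: inj => // i.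
  by have := congr1 (fun u : 'rV[int]_d => u ord0 i) e; rewrite !mxE.
apply: esum_ge; exists [set` map cell Y].
  split; first exact: finite_seq.
  move=> _ /= /mapP[y yY ->]; exists (k *: y); split; last exact: hE.
  move=> i; rewrite !mxE.
  have dk : 0 < delta / k by rewrite divr_gt0.
  have := floor_itv (y ord0 i / (delta / k)); set z := Num.floor _.
  rewrite ler_pdivlMr // ltr_pdivrMr // !mulrA !ler_pdivrMr // !ltr_pdivlMr //.
  by rewrite ![y _ _ * _]mulrC => /andP[].
rewrite -(fsbig_seq _ _ uc) big_map sumEFin lee_fin.
by rewrite -sum1_size natr_sum.
Qed.

Lemma box_ratio_ge (R : realType) (d : nat) (E : set 'rV[R]_d) (delta a t : R) :
  0 < delta -> delta < 1 -> 0 < a -> (a%:E <= N_mesh delta E)%E ->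
  t * - ln delta <= ln a -> (t%:E <= box_ratio E delta)%E.
Proof.
move=> d0 d1 a0 hN ht; rewrite /box_ratio; case: (N_mesh delta E) hN => [n| |] //=.
  rewrite !lee_fin => an.
  have l0 : 0 < - ln delta by rewrite oppr_gt0 ln_lt0 // d0 d1.
  rewrite ler_pdivlMr //; apply: le_trans ht _.
  by rewrite ler_ln // posrE // (lt_le_trans a0).
by move=> _; rewrite leey.
Qed.

Lemma lower_box_dim_ge (R : realType) (d : nat) (E : set 'rV[R]_d) (eta t : R) :
  0 < eta -> (forall delta, 0 < delta -> delta < eta -> (t%:E <= box_ratio E delta)%E) ->
  (t%:E <= lower_box_dim E)%E.
Proof.
move=> eta0 h; apply: (@le_trans _ _
  (ereal_inf [set box_ratio E delta | delta in `]0, eta[])).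
  apply: le_ereal_inf_tmp => _ [delta /= + <-].
  by rewrite in_itv /= => /andP[h1 h2]; apply: h.
apply: ereal_sup_ubound; exists eta => //=.
by rewrite in_itv /= eta0.
Qed.


(** The words used have length [3 (r + 1) nu], and [lam] is chosen so that they contract by exactly
    [m ^ (- e1 * nu)]. The factor [sg] gives [c] the norm required by [stage_norm]. *)
Lemma orbit_dimension (R : realType) (r p m : nat) (G : seq (quat int)) (e e1 b lam : R)
    (F : set 'rV[R]_(r + 3)) (c : 'rV[R]_(r + 3)) :
  free_alphabet p m G -> (4 < m)%N ->
  (forall nu, exists E, [/\ (0 < E)%N,
      (energy G (3 * nu) (near_real (8 * (m ^ nu) ^ 2)) <= E)%N &
      expR (3 * nu%:R * ln m%:R - 2 * nu%:R * e1 * ln m%:R - b) <=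
        (size G ^ (3 * nu))%:R ^+ 2 / (360 * E%:R)]) ->
  0 < e -> e <= 1 -> e1 = e / (4 * (r + 3)%:R) ->
  lam = expR (- (e1 * ln m%:R) / (3 * (r%:R + 1))) ->
  (forall f g x, g \in G -> F x -> F (gen lam f g x)) -> F c -> c <> 0 ->
  ((r%:R + 2 - e)%:E <= lower_box_dim F)%E.
Proof.
move=> HG m4 HE e0 e_1 e1E lamE hF Fc cn0.
have [b' hb'] := orbit_count r HG m4 HE.
set L : R := ln m%:R in lamE hb' *.
have L0 : 0 < L by rewrite ln_gt0 // ltr1n; apply: leq_ltn_trans m4.
have r0 : 0 <= r%:R :> R by apply: ler0n.
have rE : (r + 3)%:R = r%:R + 3 :> R by rewrite natrD.
have e1e : e1 * (r%:R + 3) = e / 4.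
  by rewrite e1E rE; field; rewrite ?gt_eqF //; lra.
have e10 : 0 < e1 by rewrite e1E rE divr_gt0 //; lra.
pose N := \sum_i c ord0 i ^+ 2.
have N0 : 0 < N.
  rewrite lt_def sumr_ge0 ?andbT => [|i _]; last exact: sqr_ge0.
  apply/negP; rewrite psumr_eq0 => [/allP h|i _]; last exact: sqr_ge0.
  apply: cn0; apply/rowP => i; rewrite mxE; apply/eqP.
  by rewrite -sqrf_eq0; apply: h; rewrite mem_index_enum.
have s0 : 0 < (stage_norm r)%:R :> R by rewrite ltr0n stage_norm_gt0.
pose sg : R := Num.sqrt ((stage_norm r)%:R / N).
have sg0 : 0 < sg by rewrite sqrtr_gt0 divr_gt0.
have sg2 : sg ^+ 2 = (stage_norm r)%:R / N by rewrite sqr_sqrtr // divr_ge0 // ltW.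
pose x := sg *: c.
have hx : \sum_i x ord0 i ^+ 2 = (stage_norm r)%:R.
  under eq_bigr do rewrite mxE exprMn.
  by rewrite -mulr_sumr sg2 -/N divfK // gt_eqF.
pose t := r%:R + 2 - e.
have t0 : 0 <= t by rewrite /t; lra.
pose B := b' + t * ((1 + e1) * L + ln sg).
(* For [nu > K] the surplus [e / 4 * (nu * L)] covers all constant losses [B]. *)
pose K := `|4 * B / (e * L)|.
have K0 : 0 <= K by apply: normr_ge0.
have lL0 : 0 < (1 + e1) * L by rewrite mulr_gt0 //; lra.
pose D0 := (1 + e1) * L * (K + 2).
pose eta := Num.min 1 (expR (- D0) / sg).
have eta0 : 0 < eta by rewrite lt_min ltr01 divr_gt0 ?expR_gt0.
apply: (lower_box_dim_ge eta0) => delta d0; rewrite lt_min => /andP[d1 dD].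
have ds0 : 0 < delta * sg by rewrite mulr_gt0.
pose D := - ln (delta * sg).
have DE : delta * sg = expR (- D) by rewrite /D opprK lnK // posrE.
have D0D : D0 < D.
  by move: dD; rewrite ltr_pdivlMr // DE ltr_expR ltrN2.
have D00 : 0 <= D0 by rewrite mulr_ge0 ?(ltW lL0) //; lra.
have Dp : 0 <= D / ((1 + e1) * L) by rewrite divr_ge0 // ltW // (le_lt_trans D00).
(* Chosen so that [delta * sg] is about [m ^ (- (1 + e1) * nu)]: resolution [m ^ (- nu)] times the
   contraction. Undoing the contraction puts [h] in the window of [orbit_count]. *)
pose nu := Num.truncn (D / ((1 + e1) * L)).
have /andP[] := truncn_itv Dp; rewrite -/nu -natr1.
rewrite ler_pdivlMr // ltr_pdivrMr // => nu1 nu2.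
have nuK : K + 1 < nu%:R.
  have : (K + 2) * ((1 + e1) * L) < (nu%:R + 1) * ((1 + e1) * L).
    by rewrite mulrC; apply: lt_trans nu2.
  by rewrite ltr_pM2r //; lra.
have nu_gt0 : (0 < nu)%N by rewrite -(ltr0n R); lra.
pose h := delta * sg * expR (nu%:R * (e1 * L)).
have hE : h = expR (nu%:R * (e1 * L) - D) by rewrite /h DE -expRD addrC.
have hlo : expR (- (nu%:R + 1 + e1) * L) <= h.
  rewrite hE ler_expR; move: nu2; rewrite !(mulrDl, mulrDr, mul1r, mulNr); lra.
have hhi : h <= expR (- nu%:R * L).
  rewrite hE ler_expR; move: nu1; rewrite !(mulrDl, mulrDr, mul1r, mulNr); lra.
have [Y [uY rY iY sY]] := hb' nu h x nu_gt0 hlo hhi hx.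
pose n := (r.+1 * (3 * nu))%N.
pose k := lam ^+ n * sg^-1.
have lamn : lam ^+ n = expR (- (nu%:R * (e1 * L))).
  rewrite lamE -expRM_natl /n; congr expR.
  rewrite !natrM -natr1; field; rewrite ?gt_eqF //; lra.
have k0 : 0 < k by rewrite /k lamn mulr_gt0 ?expR_gt0 ?invr_gt0.
have dk : delta / k = h.
  rewrite /k lamn /h expRN; field.
  by rewrite !gt_eqF ?expR_gt0.
have hY : {in Y, forall y : 'rV[R]_(r + 3), F (k *: y)}.
  move=> y /rY hy; apply: (reach_closed hF hy); rewrite /x scalerA mulVf ?gt_eqF //.
  by rewrite scale1r.
have hN : ((expR ((r%:R + 2 - 2 * (r%:R + 1) * e1) * (nu%:R * L) - b'))%:E
    <= N_mesh delta F)%E.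
  apply: le_trans (N_mesh_ge d0 k0 uY hY _); first by rewrite lee_fin.
  by rewrite dk.
apply: box_ratio_ge hN _; rewrite ?expR_gt0 // expRK -/t.
have lnd : - ln delta = D + ln sg by rewrite /D lnM ?posrE // opprD subrK.
have KB : B <= e / 4 * (nu%:R * L).
  have h1 : 4 * B / (e * L) <= K by apply: ler_norm.
  rewrite ler_pdivrMr ?mulr_gt0 // in h1.
  have h2 : K * (e * L) <= nu%:R * (e * L).
    by rewrite ler_pM2r ?mulr_gt0 // ltW // (lt_trans _ nuK) // ltrDl.
  have -> : e / 4 * (nu%:R * L) = nu%:R * (e * L) / 4 by field.
  by rewrite ler_pdivlMr // mulrC (le_trans h1).
have tD : t * D <= t * ((nu%:R + 1) * ((1 + e1) * L)) by rewrite ler_wpM2l // ltW.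
(* The difference is [e - 2 (r + 1) e1 - t e1], and both [(r + 1) e1] and [t e1] are at most
   [(r + 3) e1 = e / 4]. *)
have gam : e / 4 <= r%:R + 2 - 2 * (r%:R + 1) * e1 - t * (1 + e1).
  have g1 : (r%:R + 1) * e1 <= e1 * (r%:R + 3).
    by rewrite mulrC ler_pM2l // lerD2l ler1n.
  have g2 : t * e1 <= e1 * (r%:R + 3).
    rewrite mulrC ler_pM2l // /t; move: r0 e0; move: (r%:R) => u; clear; lra.
  move: g1 g2; rewrite e1e /t; move: (r%:R) => u; clear; lra.
have gam2 : e / 4 * (nu%:R * L) <=
    (r%:R + 2 - 2 * (r%:R + 1) * e1 - t * (1 + e1)) * (nu%:R * L).
  by rewrite ler_wpM2r // mulr_ge0 // ltW.
rewrite lnd; move: KB tD gam2; rewrite /B; clearbody t; clear.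
move: (nu%:R) (ln sg) => v l; nra.
Qed.

Theorem theorem3p2 (R : realType) (d : nat) (hd : (3 <= d)%N)
    (eps : R) (heps : 0 < eps) :
  exists (I : finType) (S : I -> 'rV[R]_d -> 'rV[R]_d),
    (forall i, contracting_similarity (S i)) /\
    exists p : 'rV[R]_d,
      is_inhom_attractor S set0 [set p] /\
      (forall F, is_inhom_attractor S set0 F -> F = [set p]) /\
      (forall c : 'rV[R]_d, c <> p ->
        forall F, is_inhom_attractor S [set c] F ->
          ((d%:R - 1 - eps)%:E <= lower_box_dim F)%E).
Proof.
have [r dE] : exists r, d = (r + 3)%N by exists (d - 3)%N; rewrite subnK.
(* Capping at 1 keeps the target exponent [r + 2 - e] nonnegative. *)
subst d; pose e := Num.min eps 1.
have e0 : 0 < e by rewrite lt_min heps ltr01.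
have e_1 : e <= 1 by rewrite ge_min lexx orbT.
have e_eps : e <= eps by rewrite ge_min lexx.
pose e1 := e / (4 * (r + 3)%:R).
have e10 : 0 < e1 by rewrite divr_gt0 // mulr_gt0 // ltr0n addn_gt0 orbT.
have [p [m [G [HG m4 [b HE]]]]] := word_energy e10.
have L0 : 0 < ln m%:R :> R by rewrite ln_gt0 // ltr1n; apply: leq_ltn_trans m4.
pose lam := expR (- (e1 * ln m%:R) / (3 * (r%:R + 1))).
have lam0 : 0 < lam by apply: expR_gt0.
have lam1 : lam < 1.
  have r1 : 0 < r%:R + 1 :> R by rewrite natr1 ltr0n.
  by rewrite /lam -[X in _ < X]expR0 ltr_expR mulNr oppr_lt0 divr_gt0 // mulr_gt0.
exists ({ffun 'I_3 -> 'I_(r + 3)} * 'I_(size G))%type.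
exists (fun s : {ffun 'I_3 -> 'I_(r + 3)} * 'I_(size G) => gen lam s.1 (nth q0 G s.2)).
have HS : forall s : {ffun 'I_3 -> 'I_(r + 3)} * 'I_(size G), exists f g,
    g \in G /\ gen lam s.1 (nth q0 G s.2) = gen lam f g.
  by move=> s; exists s.1, (nth q0 G s.2); rewrite mem_nth.
(* An empty alphabet would make the right side of the energy bound zero at [nu = 1], while the left
   side is positive. *)
have G0 : (0 < size G)%N.
  have [E [E0 _]] := HE 1%N; rewrite lt0n => hE; apply/negP => /eqP G0.
  move: hE; rewrite G0 exp0n // expr0n /= mul0r leNgt expR_gt0 //.
split; first by move=> s; apply: (gen_similarity HG lam0 lam1); rewrite mem_nth.
exists 0; split.
  apply: (attractor_origin HS); rewrite card_prod card_ffun !card_ord muln_gt0 G0.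
  by rewrite expn_gt0 addn_gt0 orbT.
split; first by move=> F; apply: (attractor_unique HG lam0 lam1 HS).
move=> c c0 F [_ [_ FE]].
have Fc : F c by rewrite FE; right.
have hF f g x : g \in G -> F x -> F (gen lam f g x).
  move=> gG Fx; rewrite FE; left.
  have gs : (index g G < size G)%N by rewrite index_mem.
  by exists (f, Ordinal gs) => //; exists x => //=; rewrite nth_index.
have := orbit_dimension HG m4 HE e0 e_1 erefl erefl hF Fc c0.
by apply: le_trans; rewrite lee_fin natrD; move: e_eps; clear; lra.
Qed.
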